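(* Let $E:[0,T]\times\mathbb{R}^m\rightrightarrows\mathbb{R}^m$ be a set-valued map such that: (E1) $E(t,z)$ is nonempty, closed, convex for all $(t,z)$; (E2) $z\mapsto E(t,z)$ has closed graph for every $t$; (E3) $z\mapsto E(t,z)$ is lower semicontinuous for every $t$; (E4) $t\mapsto E(t,z)$ is measurable for every $z$; (ELC) for every $R>0$ there is an integrable $k_R:[0,T]\to[0,\infty)$ with $E(t,x)\subset E(t,y)+k_R(t)|x-y|(\bar B^{m-1}\times[-1,1])$ for all $t\in[0,T]$, $x,y\in\bar B_R$. Let $P:[0,T]\rightrightarrows\mathbb{R}^m$ (with nonempty closed values) be absolutely continuous, and assume there is a set $C\subset(0,T)$ of full measure such that $$\forall t\in C,\ \forall z\in P(t):\quad \{1\}\times E(t,z)\subset\overline{\mathrm{conv}}\big(T_{\mathrm{gph}\,P}(t,z)\big).$$ Then for all $t_0\in(0,T)$ and $z_0\in P(t_0)$, every absolutely continuous $z:[t_0,T]\to\mathbb{R}^m$ with $\dot z(t)\in E(t,z(t))$ a.e. and $z(t_0)=z_0$ satisfies $z(t)\in P(t)$ for all $t\in[t_0,T]$.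
   Context: $\bar B_R$: closed ball radius $R$ about $0$ in $\mathbb{R}^m$; $\bar B^{m-1}$ the closed unit ball in $\mathbb{R}^{m-1}$, $\mathbb{R}^m=\mathbb{R}^{m-1}\times\mathbb{R}$. A set-valued map $F:[0,T]\rightrightarrows\mathbb{R}^m$ is measurable if $\{t:F(t)\cap U\ne\emptyset\}$ is Lebesgue measurable for every open $U$; lower semicontinuous if $\{z:F(z)\cap U\ne\emptyset\}$ is open for each open $U$. $\mathrm{gph}\,P=\{(t,z):z\in P(t)\}$; contingent cone $T_K(w)=\{v:\liminf_{\tau\to0^+}d(w+\tau v,K)/\tau=0\}$; $\overline{\mathrm{conv}}$ closed convex hull. $P$ (nonempty closed values) is absolutely continuous if for every $\varepsilon>0$ and compact $K\subset\mathbb{R}^m$ there is $\delta>0$ such that for every finite family of pairwise disjoint intervals $(t_i,s_i)\subset[0,T]$ with $\sum(s_i-t_i)<\delta$ one has $\sum d_K(P(s_i),P(t_i))<\varepsilon$, where $d_K(U,V)=\inf\{\varepsilon\ge0: U\cap K\subset V+\varepsilon\bar B,\ V\cap K\subset U+\varepsilon\bar B\}$ with $\bar B$ the closed unit ball. *)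

(* Defs.v *)
From mathcomp Require Import all_boot all_order all_algebra.
From mathcomp Require Import all_classical all_reals all_analysis.
Import numFieldNormedType.Exports.
Set Implicit Arguments. Unset Strict Implicit. Unset Printing Implicit Defensive.
Import Order.TTheory GRing.Theory Num.Theory.
Local Open Scope classical_set_scope.
Local Open Scope ring_scope.

Section Defs.
Variable R : realType.

(* Lebesgue measurable subsets of R (Caratheodory = completed sigma-algebra) *)
Definition Lmeas (A : set R) : Prop :=
  measurable (A : set (caratheodory_type (wlength (R:=R) idfun)^*%mu)).

End Defs.
Definition leb {R : realType} := @completed_lebesgue_measure R.
Section Defs2.
Variable R : realType.

Definition enorm {m : nat} (v : 'rV[R]_m) : R := Num.sqrt (\sum_i (v 0 i) ^+ 2).

Definition enorm2 {m : nat} (p : R * 'rV[R]_m) : R :=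
  Num.sqrt (p.1 ^+ 2 + \sum_i (p.2 0 i) ^+ 2).

Definition cball {m : nat} (r : R) : set 'rV[R]_m := [set x | enorm x <= r].

(* the cylinder \bar B^{m-1} x [-1,1] in R^m = R^{m-1} x R, for m = n.+1 *)
Definition cyl {n : nat} : set 'rV[R]_n.+1 :=
  [set c | Num.sqrt (\sum_(i < n.+1 | (i < n)%N) (c 0 i) ^+ 2) <= 1
           /\ `|c 0 ord_max| <= 1].

Definition cvx {m : nat} (A : set 'rV[R]_m) : Prop :=
  convex_set (A : set (convex_lmodType 'rV[R]_m)).

Definition cvx2 {m : nat} (A : set (R * 'rV[R]_m)) : Prop :=
  forall x y (l : R), A x -> A y -> 0 <= l <= 1 ->
    A (l * x.1 + (1 - l) * y.1, l *: x.2 + (1 - l) *: y.2).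

Definition clconv {m : nat} (A : set (R * 'rV[R]_m)) : set (R * 'rV[R]_m) :=
  \bigcap_(K in [set K : set (R * 'rV[R]_m) | closed K /\ cvx2 K /\ A `<=` K]) K.

(* contingent cone T_K(w) = {v | liminf_{tau -> 0+} d(w + tau v, K)/tau = 0},
   written out: for all eps, delta > 0 there is tau in (0, delta) with
   d(w + tau v, K) < eps * tau. *)
Definition tcone {m : nat} (K : set (R * 'rV[R]_m)) (w : R * 'rV[R]_m) :
    set (R * 'rV[R]_m) :=
  [set v | forall eps delta : R, 0 < eps -> 0 < delta ->
     exists tau : R, 0 < tau < delta /\
       exists k, K k /\
         enorm2 (w.1 + tau * v.1 - k.1, w.2 + tau *: v.2 - k.2) < eps * tau].

Definition gph {m : nat} (T : R) (P : R -> set 'rV[R]_m) : set (R * 'rV[R]_m) :=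
  [set p | 0 <= p.1 <= T /\ P p.1 p.2].

Definition sv_measurable {m : nat} (T : R) (F : R -> set 'rV[R]_m) : Prop :=
  forall U : set 'rV[R]_m, open U ->
    Lmeas [set t | 0 <= t <= T /\ F t `&` U !=set0].

Definition sv_lsc {m : nat} (F : 'rV[R]_m -> set 'rV[R]_m) : Prop :=
  forall U : set 'rV[R]_m, open U -> open [set z | F z `&` U !=set0].

Definition fatten {m : nat} (U : set 'rV[R]_m) (e : R) : set 'rV[R]_m :=
  [set x | exists u, U u /\ exists b, enorm b <= 1 /\ x = u + e *: b].

Definition dK {m : nat} (K U V : set 'rV[R]_m) : \bar R :=
  ereal_inf [set e%:E | e in [set e : R | 0 <= e /\
     (U `&` K `<=` fatten V e) /\ (V `&` K `<=` fatten U e)]].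

Definition disjoint_family {n : nat} (t s : 'I_n -> R) : Prop :=
  forall i j, i != j ->
    [set x | t i < x < s i] `&` [set x | t j < x < s j] = set0.

Definition sv_abs_cont {m : nat} (T : R) (P : R -> set 'rV[R]_m) : Prop :=
  forall eps : R, 0 < eps -> forall K : set 'rV[R]_m, compact K ->
  exists2 delta : R, 0 < delta &
    forall (n : nat) (t s : 'I_n -> R),
      (forall i, 0 <= t i /\ t i < s i /\ s i <= T) ->
      disjoint_family t s ->
      \sum_(i < n) (s i - t i) < delta ->
      (\sum_(i < n) dK K (P (s i)) (P (t i)) < eps%:E)%E.

Definition abs_cont_on {m : nat} (a b : R) (z : R -> 'rV[R]_m) : Prop :=
  forall eps : R, 0 < eps ->
  exists2 delta : R, 0 < delta &
    forall (n : nat) (t s : 'I_n -> R),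
      (forall i, a <= t i /\ t i < s i /\ s i <= b) ->
      disjoint_family t s ->
      \sum_(i < n) (s i - t i) < delta ->
      \sum_(i < n) enorm (z (s i) - z (t i)) < eps.

End Defs2.

(* Main.v *)
(** Let [g t] be the Euclidean distance of [z t] to [P t]; it is absolutely
    continuous.  For almost every [t] there is [l] such that
    [g (t + h) >= g t + l h - o(h)] for [h] of either sign.  If [y] is a nearest
    point of [P t] to [z t] and [q = z t - y], comparing [g] with the distance to
    points of the graph close to [(t, y) + tau (a, v)] gives
    [a l |q| <= <q, a z'(t) - v>] for every contingent direction [(a, v)] of
    either sign of [a].  This is a closed half-space, so it contains the closed
    convex hull and in particular [(1, e)] for every [e] in [E t y]; choosing [e]
    by the Lipschitz hypothesis yields [l <= 2 k(t) g t], and a Gronwall argument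
    gives [g = 0].

    Both the existence of [l] and the Gronwall step come from one comparison
    principle: if [f] is continuous, [W] is nondecreasing, and from each point one
    can move forward (or from each point backward) along a segment on which the
    increment of [f] is at most that of [W], then this also holds on the whole
    interval.  Exceptional null sets are put in an open set [U] of small measure,
    and [W] accounts for the (small) variation of [f] inside [U]. *)
Require Import Defs.
From mathcomp Require Import all_boot all_order all_algebra.
From mathcomp Require Import all_classical all_reals all_analysis.
From mathcomp Require Import measurable_realfun.
From mathcomp Require Import ring lra.
Import numFieldNormedType.Exports.
Import Order.TTheory GRing.Theory Num.Theory.
Local Open Scope classical_set_scope.
Local Open Scope ring_scope.

(** * One-sided comparison of a continuous function with a monotone one *)

Section Creep.
Set Implicit Arguments. Unset Strict Implicit.
Context {R : realType}.
Implicit Types (f W : R -> R) (a b : R).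

(** Take the supremum [c] of the points reached from [a]. It is reached, by continuity of [f] and
    because [W t <= W c] for [t <= c], so [W] may jump; if [c < b], one more step contradicts its
    choice. *)
Lemma creep_right f W a b : a <= b -> continuous f ->
  {in `[a, b] &, {homo W : x y / x <= y}} ->
  (forall t, a <= t < b -> exists2 s, t < s <= b & f s - f t <= W s - W t) ->
  f b - f a <= W b - W a.
Proof.
move=> ab cf Wnd step.
pose S := [set t | a <= t <= b /\ f t - f a <= W t - W a].
have Sa : S a by split; [rewrite lexx|rewrite !subrr].
have ubS : ubound S b by move=> t [/andP[]].
have hS : has_sup S by split; [exists a|exists b].
set c := sup S.
have ac : a <= c by apply: ub_le_sup => //; exists b.
have cb : c <= b by apply: ge_sup => //; exists a.
have Sc : S c.
  split; first by rewrite ac cb.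
  apply/ler_addgt0Pr => e e0.
  have /cvgrPdist_lt/(_ e e0) := cf c.
  rewrite near_nbhs => -[d /= d0 fd].
  have [t St ct] := sup_adherent d0 hS.
  have tc : t <= c by apply: ub_le_sup => //; exists b.
  have [tI ft] := St.
  have := fd t; rewrite /ball/= ger0_norm ?subr_ge0//.
  rewrite -/c in ct.
  move=> /(_ ltac:(by lra)).
  have : W t <= W c by apply: Wnd => //; rewrite in_itv/= ?ac.
  rewrite ltr_norml; lra.
have [cb'|] := ltP c b; last first.
  by move=> bc; have <- : c = b by [lra]; exact: Sc.2.
have [s /andP[cs sb] fs] := step c ltac:(by rewrite ac).
suff : s <= c by lra.
apply: ub_le_sup; first by exists b.
by split; [lra|have := Sc.2; lra].
Qed.

(** Reflection in the origin: both functions also change sign, so that [W] stays nondecreasing. *)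
Lemma creep_left f W a b : a <= b -> continuous f ->
  {in `[a, b] &, {homo W : x y / x <= y}} ->
  (forall t, a < t <= b -> exists2 s, a <= s < t & f t - f s <= W t - W s) ->
  f b - f a <= W b - W a.
Proof.
move=> ab cf Wnd step.
have := @creep_right (fun x => - f (- x)) (fun x => - W (- x)) (- b) (- a).
rewrite !opprK => H.
suff : - f a + f b <= - W a + W b by lra.
apply: H; first by lra.
- move=> x; apply: continuousN; apply: continuous_comp; last exact: cf.
  exact: opp_continuous.
- move=> x y; rewrite !in_itv/= => xI yI xy.
  by rewrite lerN2; apply: Wnd; rewrite ?in_itv/=; lra.
- move=> t tI; have [|s sI fs] := step (- t); first by lra.
  by exists (- s); rewrite ?opprK; lra.
Qed.

End Creep.

(** * Absolute continuity through ordered families of intervals *)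

Section AbsCont.
Set Implicit Arguments. Unset Strict Implicit.
Context {R : realType}.
Notation mu := (@lebesgue_measure R).
Implicit Types (f : R -> R) (U : set R) (a b t S L : R).

(* [fam U f a t S L]: some increasing finite family of intervals, contained in
   [U] and lying in [a, t], has total length [L] and f-variation [S]. *)
Inductive fam U f a : R -> R -> R -> Prop :=
| fam_nil t : a <= t -> fam U f a t 0 0
| fam_cons t S L u v w : fam U f a t S L -> t <= u -> u < v -> v <= w ->
    [set` `]u, v[] `<=` U ->
    fam U f a w (S + `|f v - f u|) (L + (v - u)).

(** Absolute continuity in the usual sense: the intervals of a [fam] are ordered, so disjointness is
    built in. *)
Definition ac f a b := forall e, 0 < e -> exists2 d, 0 < d &
  forall S L, fam setT f a b S L -> L < d -> S <= e.

Lemma fam_ge U f a t S L : fam U f a t S L -> a <= t.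
Proof. by elim=> // {}t {}S {}L u v w _ *; lra. Qed.

Lemma fam_le U f a t t' S L : t <= t' -> fam U f a t S L -> fam U f a t' S L.
Proof.
move=> + H; case: H t' => {t S L} [t at_ t' tt'|t S L u v w H *].
  by apply: fam_nil; lra.
by apply: fam_cons H _ _ _ _ => //; lra.
Qed.

Lemma famS U V f a t S L : U `<=` V -> fam U f a t S L -> fam V f a t S L.
Proof.
move=> UV; elim=> {t S L} [t|t S L u v w _ H *]; first exact: fam_nil.
by apply: fam_cons H _ _ _ _ => //; apply: subset_trans UV.
Qed.

Lemma fam_widen U f a b c t S L : a <= c -> t <= b ->
  fam U f c t S L -> fam U f a b S L.
Proof.
move=> ac tb H; elim: H b tb => {t S L} [t ct b tb|t S L u v w _ H *].
  by apply: fam_nil; lra.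
by apply: fam_cons (H t _) _ _ _ _ => //; lra.
Qed.

Lemma ac_sub f a b c d : a <= c -> d <= b -> ac f a b -> ac f c d.
Proof.
move=> ac_ db H e e0; have [r r0 Hr] := H e e0; exists r => // S L /fam_widen.
by move=> /(_ _ _ ac_ db)/Hr.
Qed.

(** By induction: the intervals counted so far lie left of [t], so the measure of the next one
    simply adds. *)
Lemma fam_length U f a t S L : measurable (U : set (measurableTypeR R)) ->
  fam U f a t S L -> (L%:E <= mu (U `&` `[a, t]))%E.
Proof.
move=> mU; elim=> {t S L} [t _|t S L u v w H IH tu uv vw uvU].
  exact: measure_ge0.
have at_ := fam_ge H.
rewrite EFinD; apply: (@le_trans _ _ (mu (U `&` `[a, t]) + mu `]u, v[)%E).
  by rewrite leeD// lebesgue_measure_itv/= lte_fin uv.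
rewrite -measureU//=; last 2 first.
- exact: measurableI.
- rewrite -subset0 => x /= [[_ ]]; rewrite !in_itv/=; lra.
apply: le_measure; rewrite ?inE.
- by apply: measurableU => //; exact: measurableI.
- exact: measurableI.
- move=> x [[Ux xI]|xI]; split => //=.
  + by move: xI; rewrite /= !in_itv/=; lra.
  + exact: uvU.
  + by move: xI; rewrite /= !in_itv/=; lra.
Qed.

(* [W t] is the total variation of [f] on the part of [U] in [[a, t]]. *)
Lemma ac_small_variation f a b e : ac f a b -> 0 < e -> exists2 d, 0 < d &
  forall U, open U -> (mu U < d%:E)%E ->
  exists W : R -> R, [/\ {in `[a, b] &, {homo W : x y / x <= y}},
    forall t, a <= t <= b -> 0 <= W t <= e &
    forall t s, a <= t <= s -> s <= b -> `]t, s[ `<=` U -> `|f s - f t| <= W s - W t].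
Proof.
move=> acf e0; have [d d0 dP] := acf e e0; exists d => // U oU Ud.
have mU : measurable (U : set (measurableTypeR R)) by exact: open_measurable.
(* The total variation is the supremum of [V t]; it is at most [e], as a family inside [U] has total
   length below [d]. *)
pose V t := [set S | exists L, fam U f a t S L].
have V0 t : a <= t -> V t 0 by move=> at_; exists 0; exact: fam_nil.
have Ve t : t <= b -> ubound (V t) e.
  move=> tb S [L H]; apply: (dP S L).
    by apply: famS (fam_le tb H).
  rewrite -lte_fin; apply: le_lt_trans Ud.
  apply: le_trans (fam_length mU H) _.
  by apply: le_measure; rewrite ?inE//; exact: measurableI.
have ubV t : a <= t -> t <= b -> has_sup (V t).
  by move=> at_ tb; split; [exists 0; exact: V0|exists e; exact: Ve].
exists (sup \o V); split => [t s||].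
- rewrite !in_itv/= => /andP[at_ tb] /andP[as_ sb] ts.
  apply: ge_sup; first by exists 0; exact: V0.
  move=> S [L H]; apply: ub_le_sup; first by case: (ubV s).
  by exists L; exact: fam_le H.
- move=> t /andP[at_ tb] /=; apply/andP; split.
    by apply: ub_le_sup; [case: (ubV t)|exact: V0].
  by apply: ge_sup; [exists 0; exact: V0|exact: Ve].
- move=> t s /andP[at_ ts] sb tsU /=.
  suff : sup (V t) <= sup (V s) - `|f s - f t| by lra.
  apply: ge_sup; first by exists 0; exact: V0.
  move=> S [L H]; rewrite lerBrDr.
  (* For [t < s] the interval from [t] to [s] is appended to a family ending at [t]; [fam_cons]
     excludes a degenerate one. *)
  have [<-|nts] := eqVneq t s.
    rewrite subrr normr0 addr0; apply: ub_le_sup; last by exists L.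
    by case: (ubV t) => //; lra.
  apply: ub_le_sup; first by case: (ubV s) => //; lra.
  exists (L + (s - t)); apply: fam_cons H _ _ _ _ => //.
  by rewrite lt_neqAle nts.
Qed.

End AbsCont.

(** * Measure of a set from slopes, and small open neighbourhoods *)

Section Covers.
Set Implicit Arguments. Unset Strict Implicit.
Context {R : realType}.
Notation mu := (@lebesgue_measure R).
Implicit Types (f W : R -> R) (E F U : set R) (a b c d t : R).

Lemma lebesgue_bounded_lty E a b : measurable (E : set (measurableTypeR R)) ->
  E `<=` `[a, b] -> (mu E < +oo)%E.
Proof.
move=> mE EI; apply: le_lt_trans (_ : (mu `[a, b] < +oo)%E).
  by apply: le_measure; rewrite ?inE.
by rewrite lebesgue_measure_itv/=; case: ifP => // _; rewrite -EFinB ltry.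
Qed.

Lemma lebesgue_itvoc_length c d : c <= d -> mu `]c, d] = (d - c)%:E.
Proof.
by rewrite lebesgue_measure_itv/= lte_fin le_eqVlt => /predU1P[->|->]//;
  rewrite ltxx subrr.
Qed.

(** Apply [creep_right] to [c] times the measure of [F] to the left of [t]. This measure is
    1-Lipschitz, so on [F] the slope of [W] dominates it, and it stays constant just to the right of
    a point outside [F]. *)
Lemma closed_measure_le F W a b c : closed F -> F `<=` `[a, b] -> a <= b ->
  0 <= c -> {in `[a, b] &, {homo W : x y / x <= y}} ->
  (forall t, F t -> exists2 d, 0 < d &
     forall s, t < s < t + d -> s <= b -> c * (s - t) <= W s - W t) ->
  (c%:E * mu F <= (W b - W a)%:E)%E.
Proof.
move=> cF FI ab c0 Wnd slope.
have mF : measurable (F : set (measurableTypeR R)) by exact: closed_measurable.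
pose G t : set R := F `&` `]-oo, t].
have mG t : measurable (G t : set (measurableTypeR R)) by exact: measurableI.
have finG t : mu (G t) \is a fin_num.
  rewrite ge0_fin_numE//; apply: (@lebesgue_bounded_lty _ a b) => //.
  by move=> x [/FI].
pose m t := fine (mu (G t)).
have mS t s : t <= s -> mu (G s) = (mu (G t) + mu (F `&` `]t, s]))%E.
  move=> ts; rewrite -measureU//=; last 2 first.
  - exact: measurableI.
  - rewrite -subset0 => x [[_]]; rewrite /= in_itv/= => xt [_]; rewrite /= in_itv/=; lra.
  congr (mu _); apply/seteqP; split => [x [Fx]|x [] [Fx]]; rewrite /= ?in_itv/=.
  - by move=> xs; have [xt|tx] := leP x t; [left|right]; split; rewrite //= ?in_itv/= ?tx.
  - by move=> xt; split => //=; rewrite ?in_itv/=; lra.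
  - by move=> xt; split => //=; rewrite ?in_itv/=; lra.
have mD t s : t <= s -> 0 <= m s - m t <= s - t.
  move=> ts.
  have le_ts : (mu (F `&` `]t, s]) <= (s - t)%:E)%E.
    rewrite -lebesgue_itvoc_length//; apply: le_measure; rewrite ?inE//.
    exact: measurableI.
  have fin_ts : mu (F `&` `]t, s]) \is a fin_num.
    by rewrite ge0_fin_numE// (le_lt_trans le_ts)// ltry.
  rewrite /m (mS _ _ ts) fineD//.
  have : 0 <= fine (mu (F `&` `]t, s])) by exact: fine_ge0.
  by move: le_ts; rewrite -{1}(fineK fin_ts) lee_fin; lra.
have cm : continuous (fun t => c * m t).
  move=> t; apply: cvgM; first exact: cvg_cst.
  apply/cvgrPdist_lt => e e0; exists e => //= s; rewrite /ball_/= !ltr_norml.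
  by have [/mD|/ltW/mD] := leP t s; lra.
have : c * m b - c * m a <= W b - W a.
  apply: (@creep_right _ (fun t => c * m t)) => // t /andP[at_ tb].
  have [/slope[d d0 sl]|nFt] := pselect (F t).
    exists (Num.min b (t + d / 2)).
      rewrite lt_min ge_min lexx tb; lra.
    set s := Num.min _ _.
    have ts : t < s by rewrite lt_min tb; lra.
    have sb : s <= b by rewrite ge_min lexx.
    have sd : s <= t + d / 2 by rewrite ge_min lexx orbT.
    rewrite -mulrBr; apply: le_trans (sl s _ _); [|lra|lra].
    by have := mD t s ltac:(lra); nra.
  have : open (~` F) by exact: closed_openC.
  rewrite openE => /(_ t nFt)[d /= d0 dF].
  exists (Num.min b (t + d / 2)).
    rewrite lt_min ge_min lexx tb; lra.
  set s := Num.min _ _.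
  have ts : t < s by rewrite lt_min tb; lra.
  have sb : s <= b by rewrite ge_min lexx.
  have sd : s <= t + d / 2 by rewrite ge_min lexx orbT.
  have -> : m s = m t.
    rewrite /m (mS t s) ?(ltW ts)//.
    suff -> : F `&` `]t, s] = set0 by rewrite measure0 adde0.
    rewrite -subset0 => x [Fx]; rewrite /= in_itv/= => xI.
    by apply: (dF x) => //; rewrite /ball/= ltr_norml; lra.
  by rewrite subrr subr_ge0; apply: Wnd; rewrite ?in_itv/=; lra.
have ma : mu (G a) = 0%E.
  apply: (@subset_measure0 _ _ _ mu (G a) [set a]) => //.
  - by move=> x [/FI]; rewrite /= !in_itv/= => /andP[ax _] xa; apply/eqP; rewrite eq_le xa.
  - exact: lebesgue_measure_set1.
have Gb : G b = F.
  apply/seteqP; split => [x []//|x Fx]; split => //.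
  by have := FI x Fx; rewrite /= !in_itv/= => /andP[].
have mb : mu F = (m b)%:E by rewrite /m fineK// Gb.
by rewrite {1}/m mb/= -EFinM lee_fin/m ma Gb mulr0 subr0.
Qed.

Lemma ac_id a b : ac (@id R) a b.
Proof.
move=> e e0; exists e => // S L; suff H : fam setT id a b S L -> S = L.
  by move=> /H -> /ltW.
elim=> {S L} // t S L u v w _ -> tu uv vw _.
by rewrite ger0_norm ?subr_ge0// ltW.
Qed.

(* The term in [M] makes [W] also dominate the variation of [f - r id], for
   [|r| <= M], near the points of [U] outside [E]. *)
Lemma ac_cover f a b E M e : ac f a b -> 0 <= M ->
  measurable (E : set (measurableTypeR R)) -> E `<=` `]a, b[ -> 0 < e ->
  exists F U W, [/\ closed F, F `<=` E, (mu E <= mu F + e%:E)%E,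
    open U & E `<=` U] /\ [/\ U `<=` `]a, b[,
    {in `[a, b] &, {homo W : x y / x <= y}},
    forall t, a <= t <= b -> 0 <= W t <= e &
    forall t, U t -> ~ E t -> exists2 d, 0 < d &
      forall u v, t - d < u -> u <= v -> v < t + d -> a <= u -> v <= b ->
       `|f v - f u| + M * (v - u) <= W v - W u].
Proof.
move=> acf M0 mE EI e0.
have Eoo : (mu E < +oo)%E.
  apply: (@lebesgue_bounded_lty _ a b) => // x /EI/=.
  by rewrite !in_itv/=; lra.
have [F [cF FE EF]] := lebesgue_regularity_inner mE Eoo e0.
have e20 : 0 < e / 2 by lra.
(* [M * V] must stay below [e / 2]; dividing by [M + 1] also covers [M = 0]. *)
have eM0 : 0 < e / 2 / (M + 1) by rewrite divr_gt0//; lra.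
have [d1 d10 d1P] := ac_small_variation acf e20.
have [d2 d20 d2P] := ac_small_variation (@ac_id a b) eM0.
pose d := Num.min d1 d2.
have d0 : 0 < d by rewrite lt_min d10.
have {}d20 : 0 < d / 2 by lra.
have [U0 [oU0 EU0 U0E]] := lebesgue_regularity_outer mE Eoo d20.
pose U := U0 `&` `]a, b[.
have oU : open U by apply: openI => //; exact: interval_open.
have mU : measurable (U : set (measurableTypeR R)) by exact: open_measurable.
have mU0 : measurable (U0 : set (measurableTypeR R)) by exact: open_measurable.
have UEd : (mu (U `\` E) < (d / 2)%:E)%E.
  apply: le_lt_trans U0E; apply: le_measure; rewrite ?inE.
  - exact: measurableD.
  - exact: measurableD.
  - by move=> x [[]].
have UEoo : (mu (U `\` E) < +oo)%E by apply: lt_trans UEd _; rewrite ltry.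
(* [U1] is open and covers [U] minus [E] with measure below [d]. So [f] and the identity vary little
   inside it, and each point of [U] outside [E] has an interval around it contained in [U1]. *)
have [U1 [oU1 UEU1 U1UE]] := lebesgue_regularity_outer
  (measurableD mU mE) UEoo d20.
have mU1 : measurable (U1 : set (measurableTypeR R)) by exact: open_measurable.
have U1d : (mu U1 < d%:E)%E.
  rewrite (_ : U1 = (U `\` E) `|` (U1 `\` (U `\` E))); last first.
    by rewrite setDUK.
  rewrite measureU//; last exact: setDIK.
  - by rewrite (splitr d) EFinD lteD.
  - exact: measurableD.
  - by apply: measurableD => //; exact: measurableD.
have [|W [W1 W2 W3]] := d1P U1 oU1.
  by apply: lt_le_trans U1d _; rewrite lee_fin ge_min lexx.
have [|V [V1 V2 V3]] := d2P U1 oU1.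
  by apply: lt_le_trans U1d _; rewrite lee_fin ge_min lexx orbT.
have clF : closed F by apply: compact_closed => //; exact: Rhausdorff.
have mF : measurable (F : set (measurableTypeR R)) by exact: closed_measurable.
exists F, U, (fun t => W t + M * V t); split; split => //.
- rewrite -[in leLHS](setDUK FE) measureU//; last exact: setDIK.
    by rewrite leeD2l// ltW.
  exact: measurableD.
- by move=> x Ex; split; [exact: EU0|exact: EI].
- by move=> x [].
- move=> x y xI yI xy /=; apply: lerD; first exact: W1.
  by apply: ler_wpM2l => //; exact: V1.
- move=> t tI; have := W2 t tI; have := V2 t tI => /andP[V0 Ve].
  suff : 0 <= M * V t <= e / 2 by lra.
  rewrite mulr_ge0//=; move: Ve; rewrite ler_pdivlMr; last by lra.
  by rewrite mulrC; nra.
- move=> t Ut nEt.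
  have := oU1; rewrite openE => /(_ t (UEU1 t (conj Ut nEt)))[r /= r0 rU].
  exists r => // u v tu uv vt au vb.
  have uvU1 : `]u, v[ `<=` U1.
    move=> x /=; rewrite in_itv/= => xI; apply: rU.
    by rewrite /ball/= ltr_norml; lra.
  have := W3 u v; have := V3 u v; rewrite au uv (ger0_norm (x := v - u)) ?subr_ge0//.
  move=> /(_ isT vb uvU1) VV /(_ isT vb uvU1) WW.
  have : M * (v - u) <= M * (V v - V u) by apply: ler_wpM2l.
  by lra.
Qed.

End Covers.

(** * Dini derivatives and their exceptional sets *)

Section DiniDerivatives.
Set Implicit Arguments. Unset Strict Implicit.
Context {R : realType}.
Notation mu := (@lebesgue_measure R).
Implicit Types (f W : R -> R) (E F U : set R) (a b c d r t : R).

(* Implied by [D_+ f t < r] and implies [D_+ f t <= r]. *)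
Definition dini_low f r : set R := \bigcap_(n in [set: nat])
  [set t | exists2 h, 0 < h < n.+1%:R^-1 & f (t + h) - f t < r * h].

(* Implied by [r < D^- f t] and implies [r <= D^- f t]. *)
Definition dini_up f r : set R := \bigcap_(n in [set: nat])
  [set t | exists2 h, 0 < h < n.+1%:R^-1 & r * h < f t - f (t - h)].

Lemma natSinv_lt (e : R) : 0 < e -> exists n : nat, n.+1%:R^-1 < e.
Proof.
move=> e0; have := near_infty_natSinv_lt (PosNum e0).
by case=> n _ /(_ n (leqnn n)) /=; exists n.
Qed.

Lemma dini_lowP f r t : dini_low f r t <->
  forall e, 0 < e -> exists2 h, 0 < h < e & f (t + h) - f t < r * h.
Proof.
split=> [H e /natSinv_lt[n ne]|H n _]; last by apply: H; rewrite invr_gt0.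
have [h /andP[h0 hn] fh] := H n I; exists h => //.
  by rewrite h0 (lt_trans hn).
Qed.

Lemma dini_upP f r t : dini_up f r t <->
  forall e, 0 < e -> exists2 h, 0 < h < e & r * h < f t - f (t - h).
Proof.
split=> [H e /natSinv_lt[n ne]|H n _]; last by apply: H; rewrite invr_gt0.
have [h /andP[h0 hn] fh] := H n I; exists h => //.
  by rewrite h0 (lt_trans hn).
Qed.

(** For fixed [n] the condition defines a union over [h] of open sets, by continuity of [f]; the
    whole is a countable intersection of open sets. *)
Lemma measurable_dini_low f r : continuous f ->
  measurable (dini_low f r : set (measurableTypeR R)).
Proof.
move=> cf; apply: bigcapT_measurable => n; apply: open_measurable.
rewrite (_ : [set t | _] = \bigcup_(h in [set h | 0 < h < n.+1%:R^-1])
   ((fun t => f (t + h) - f t) @^-1` [set x | x < r * h])); last first.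
  by apply/seteqP; split => [t [h hn fh]|t [h /= hn fh]]; exists h.
apply: bigcup_open => h _; apply: open_comp; last exact: open_lt.
move=> t _; apply: cvgB; last exact: cf.
by apply: continuous_comp; [apply: cvgD; [exact: cvg_id|exact: cvg_cst]|exact: cf].
Qed.

Lemma measurable_dini_up f r : continuous f ->
  measurable (dini_up f r : set (measurableTypeR R)).
Proof.
move=> cf; apply: bigcapT_measurable => n; apply: open_measurable.
rewrite (_ : [set t | _] = \bigcup_(h in [set h | 0 < h < n.+1%:R^-1])
   ((fun t => f t - f (t - h)) @^-1` [set x | r * h < x])); last first.
  by apply/seteqP; split => [t [h hn fh]|t [h /= hn fh]]; exists h.
apply: bigcup_open => h _; apply: open_comp; last exact: open_gt.
move=> t _; apply: cvgB; first exact: cf.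
by apply: continuous_comp; [apply: cvgB; [exact: cvg_id|exact: cvg_cst]|exact: cf].
Qed.

Section Slopes.
Variables (f W : R -> R) (a b M : R) (E U : set R).
Hypothesis cf : continuous f.
Hypothesis Uab : U `<=` `]a, b[.
Hypothesis Wnd : {in `[a, b] &, {homo W : x y / x <= y}}.
Hypothesis Wloc : forall t, U t -> ~ E t -> exists2 d, 0 < d &
  forall u v, t - d < u -> u <= v -> v < t + d -> a <= u -> v <= b ->
    `|f v - f u| + M * (v - u) <= W v - W u.

Let inab c d t : `[c, d] `<=` U -> c <= t <= d -> a < t < b.
Proof. by move=> cdU tI; have := Uab (cdU t tI). Qed.

Let Wcd c d : `[c, d] `<=` U -> {in `[c, d] &, {homo W : x y / x <= y}}.
Proof.
move=> cdU x y; rewrite !in_itv/= => /(inab cdU) xI /(inab cdU) yI.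
by apply: Wnd; rewrite in_itv/=; lra.
Qed.

(** [creep_right] for [f - r id]: at points of [E] there is a forward step of slope below [r], and
    at the other points [Wloc] pays for [f] and, as [|r| <= M], for [r id]. *)
Lemma slope_low r c d : `|r| <= M -> E `<=` dini_low f r -> c <= d ->
  `[c, d] `<=` U -> f d - f c <= r * (d - c) + (W d - W c).
Proof.
rewrite ler_norml => rM Er cd cdU.
suff : (f d - r * d) - (f c - r * c) <= W d - W c by lra.
apply: (@creep_right _ (fun t => f t - r * t)) => //.
- move=> t; apply: cvgB; first exact: cf.
  by apply: cvgM; [exact: cvg_cst|exact: cvg_id].
- exact: Wcd.
- move=> t tI; have tI' := inab cdU (t := t) ltac:(lra).
  have [/Er/dini_lowP/(_ (d - t))[|h hI fh]|nEt] := pselect (E t); first by lra.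
    exists (t + h); first by lra.
    have : W t <= W (t + h) by apply: (Wcd cdU); rewrite ?in_itv/=; lra.
    lra.
  have [|e e0 He] := Wloc _ nEt; first by apply: cdU; rewrite /= in_itv/=; lra.
  exists (Num.min d (t + e / 2)); first by rewrite lt_min ge_min lexx; lra.
  set s := Num.min _ _.
  have ts : t < s by rewrite lt_min; lra.
  have sd : s <= d by rewrite ge_min lexx.
  have se : s <= t + e / 2 by rewrite ge_min lexx orbT.
  have := inab cdU (t := d) ltac:(lra) => dI.
  have := He t s ltac:(lra) ltac:(lra) ltac:(lra) ltac:(lra) ltac:(lra).
  have : f s - f t <= `|f s - f t| by exact: ler_norm.
  have : - (r * (s - t)) <= M * (s - t) by rewrite -mulNr ler_wpM2r; lra.
  lra.
Qed.

(** Mirror image with [creep_left], since [dini_up] provides steps to the left. *)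
Lemma slope_up r c d : `|r| <= M -> E `<=` dini_up f r -> c <= d ->
  `[c, d] `<=` U -> r * (d - c) - (W d - W c) <= f d - f c.
Proof.
rewrite ler_norml => rM Er cd cdU.
suff : (r * d - f d) - (r * c - f c) <= W d - W c by lra.
apply: (@creep_left _ (fun t => r * t - f t)) => //.
- move=> t; apply: cvgB; last exact: cf.
  by apply: cvgM; [exact: cvg_cst|exact: cvg_id].
- exact: Wcd.
- move=> t tI; have tI' := inab cdU (t := t) ltac:(lra).
  have [/Er/dini_upP/(_ (t - c))[|h hI fh]|nEt] := pselect (E t); first by lra.
    exists (t - h); first by lra.
    have : W (t - h) <= W t by apply: (Wcd cdU); rewrite ?in_itv/=; lra.
    lra.
  have [|e e0 He] := Wloc _ nEt; first by apply: cdU; rewrite /= in_itv/=; lra.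
  exists (Num.max c (t - e / 2)); first by rewrite gt_max le_max lexx; lra.
  set s := Num.max _ _.
  have ts : s < t by rewrite gt_max; lra.
  have sd : c <= s by rewrite le_max lexx.
  have se : t - e / 2 <= s by rewrite le_max lexx orbT.
  have := inab cdU (t := c) ltac:(lra) => dI.
  have := He s t ltac:(lra) ltac:(lra) ltac:(lra) ltac:(lra) ltac:(lra).
  have : - (f t - f s) <= `|f t - f s| by rewrite -normrN ler_norm.
  have : r * (t - s) <= M * (t - s) by rewrite ler_wpM2r; lra.
  lra.
Qed.

End Slopes.

Lemma open_segment U t : open U -> U t -> exists2 d, 0 < d &
  forall s, t < s < t + d -> `[t, s] `<=` U.
Proof.
rewrite openE => /(_ t)/[apply] -[d /= d0 dU]; exists d => // s sI x.
by rewrite /= in_itv/= => xI; apply: dU; rewrite /ball/= ltr_norml; lra.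
Qed.

(** Together the two bounds give [q |E| <= (k + q) e], with [e] arbitrary. *)
Lemma measure_le_small E q k : 0 < q -> 0 <= k -> (mu E < +oo)%E ->
  (forall e, 0 < e -> exists2 F, (mu E <= mu F + e%:E)%E &
     (q%:E * mu F <= (k * e)%:E)%E) -> mu E = 0%E.
Proof.
move=> q0 k0 Eoo H; have Efin : mu E \is a fin_num by rewrite ge0_fin_numE.
apply/eqP; rewrite eq_le measure_ge0 andbT -(fineK Efin) lee_fin.
apply/ler_addgt0Pl => e e0; rewrite addr0.
have e'0 : 0 < e * q / (k + q) by rewrite divr_gt0 ?mulr_gt0//; lra.
have [F EF Fe] := H _ e'0.
have Ffin : mu F \is a fin_num.
  rewrite ge0_fin_numE// ltey; apply: contraTneq Fe => ->.
  by rewrite mulry gtr0_sg// mul1e -ltNge ltry.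
move: EF Fe; rewrite -(fineK Efin) -(fineK Ffin) -EFinD -EFinM !lee_fin.
set m := fine (mu E); set p := fine (mu F); set e' := _ / _ => mp pq.
have ee' : e' * (k + q) = e * q by rewrite /e' divfK//; lra.
have : m * q <= e * q by rewrite -ee'; nra.
by rewrite ler_pM2r.
Qed.

(* On segments of a neighbourhood [U] of the set, the slope of [f] is at most [r]
   and at least [r'] up to the increments of [W], so [(r' - r) |F| <= 2 W(b)]. *)
Lemma dini_gap_null f a b r r' : continuous f -> ac f a b -> r < r' ->
  mu (dini_low f r `&` dini_up f r' `&` `]a, b[) = 0%E.
Proof.
move=> cf acf rr'; set E := _ `&` _.
have [ab|ba] := ltP a b; last first.
  rewrite /E set_itv_ge ?setI0 ?measure0//.
  by rewrite bnd_simp -leNgt.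
have mE : measurable (E : set (measurableTypeR R)).
  apply: measurableI => //; apply: measurableI.
    exact: measurable_dini_low. exact: measurable_dini_up.
have EI : E `<=` `]a, b[ by move=> t [].
apply: (@measure_le_small _ (r' - r) 2); [lra|lra| |].
  by apply: (@lebesgue_bounded_lty _ _ a b) => // t [_]/=; rewrite !in_itv/=; lra.
move=> e e0.
have [|F [U [W [[clF FE EF oU EU] [Uab Wnd We Wloc]]]]] :=
  @ac_cover _ f a b E (`|r| + `|r'|) e acf _ mE EI e0; first by rewrite addr_ge0.
exists F => //.
apply: (@le_trans _ _ (2 * W b - 2 * W a)%:E); last first.
  have := We a; have := We b; rewrite !lexx (ltW ab) => /(_ isT) ? /(_ isT) ?.
  by rewrite lee_fin; lra.
apply: (@closed_measure_le _ F (fun t => 2 * W t)) => //.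
- by move=> t /FE/EI/=; rewrite !in_itv/=; lra.
- exact: ltW.
- lra.
- by move=> x y xI yI xy; rewrite ler_pM2l//; exact: Wnd.
- move=> t Ft; have [d d0 dU] := open_segment oU (EU _ (FE _ Ft)).
  exists d => // s sI _.
  have E1 : E `<=` dini_low f r by move=> x [[]].
  have E2 : E `<=` dini_up f r' by move=> x [[]].
  have := slope_low cf Uab Wnd Wloc _ E1 (c := t) (d := s) _ (dU s sI).
  have := slope_up cf Uab Wnd Wloc _ E2 (c := t) (d := s) _ (dU s sI).
  rewrite lerDl lerDr !normr_ge0 => /(_ isT ltac:(lra)) ? /(_ isT ltac:(lra)) ?.
  lra.
Qed.

(** On an interval shorter than [d] the variation of [f] is at most 1 and is recorded by [V],
    whereas near a point of the set the slope of [f] is at least [n.+1] in absolute value, up to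
    [W]. So the measure is of order [1 / n.+1]. *)
Lemma infinite_dini_null f a b E : continuous f -> ac f a b ->
  measurable (E : set (measurableTypeR R)) ->
  (forall n : nat, E `<=` dini_low f (- n%:R)) \/
  (forall n : nat, E `<=` dini_up f n%:R) ->
  exists2 d, 0 < d & forall c c', a <= c -> c' <= b -> c' - c < d ->
    mu (E `&` `]c, c'[) = 0%E.
Proof.
move=> cf acf mE0 HE0.
have [d d0 dP] := ac_small_variation acf ltr01; exists d => // c c' ac_ c'b cd.
have [cc'|c'c] := ltP c c'; last first.
  by rewrite set_itv_ge ?setI0 ?measure0// bnd_simp -leNgt.
have oI : open (`]c, c'[%classic : set R) by exact: interval_open.
have [|V [V1 V2 V3]] := dP _ oI.
  by rewrite lebesgue_measure_itv/= lte_fin cc' -EFinB lte_fin.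
set E' := E `&` _.
have mE : measurable (E' : set (measurableTypeR R)) by exact: measurableI.
have EI : E' `<=` `]c, c'[ by move=> t [].
have {}acf : ac f c c' by apply: ac_sub acf.
have Eoo : (mu E' < +oo)%E.
  by apply: (@lebesgue_bounded_lty _ _ c c') => // t /EI/=; rewrite !in_itv/=; lra.
apply: (@measure_le_small _ 1 3) => // e e0.
(* With [1 < n.+1 * e], the estimate [n.+1 |F| <= 1 + e] obtained below gives [|F| <= 2 e]. *)
have [n ne] := natSinv_lt e0.
have ne1 : 1 < n.+1%:R * e by rewrite mulrC -ltr_pdivrMr// div1r.
have [|F [U [W [[clF FE EF oU EU] [Uab Wnd We Wloc]]]]] :=
  @ac_cover _ f c c' E' n.+1%:R e acf _ mE EI e0; first by [].
exists F => //.
have Foo : mu F \is a fin_num.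
  rewrite ge0_fin_numE//; apply: le_lt_trans Eoo; apply: le_measure; rewrite ?inE//.
  exact: closed_measurable.
have : (n.+1%:R%:E * mu F <= ((V c' + W c') - (V c + W c))%:E)%E.
  apply: (@closed_measure_le _ F (fun t => V t + W t)) => //.
  - by move=> t /FE/EI/=; rewrite !in_itv/=; lra.
  - exact: ltW.
  - move=> x y xI yI xy; apply: lerD; last exact: Wnd.
    by apply: V1 => //; move: xI yI; rewrite !in_itv/=; lra.
  move=> t Ft; have [d' d'0 dU] := open_segment oU (EU _ (FE _ Ft)).
  exists d' => // s sI sc'.
  have tI := EI _ (FE _ Ft); rewrite /= in_itv/= in tI.
  have := V3 t s ltac:(lra) ltac:(lra).
  have /[swap]/[apply] : `]t, s[ `<=` `]c, c'[.
    by move=> x /=; rewrite !in_itv/=; lra.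
  rewrite ler_norml.
  have [E1|E1] : E' `<=` dini_low f (- n.+1%:R) \/ E' `<=` dini_up f n.+1%:R.
    by case: HE0 => H; [left|right] => x [/H].
  - have := slope_low cf Uab Wnd Wloc _ E1 (c := t) (d := s) _ (dU s sI).
    by rewrite normrN ger0_norm// => /(_ (lexx _) ltac:(lra)); lra.
  - have := slope_up cf Uab Wnd Wloc _ E1 (c := t) (d := s) _ (dU s sI).
    by rewrite ger0_norm// => /(_ (lexx _) ltac:(lra)); lra.
rewrite -(fineK Foo) -!EFinM !lee_fin mul1r.
have := We c; have := We c'; rewrite !lexx (ltW cc') => /(_ isT) ? /(_ isT) ?.
have := V2 c; have := V2 c'.
move=> /(_ ltac:(lra)) ? /(_ ltac:(lra)) ? H.
have : 1 <= n.+1%:R :> R by rewrite ler1n.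
have := fine_ge0 (measure_ge0 mu F).
nra.
Qed.

End DiniDerivatives.

(** * Existence of a subgradient almost everywhere *)

Section Subdifferential.
Set Implicit Arguments. Unset Strict Implicit.
Context {R : realType}.
Notation mu := (@lebesgue_measure R).
Implicit Types (f : R -> R) (a b l t : R).

Lemma countable_bigcup_null (I : countType) (A : I -> set R) :
  (forall i, measurable (A i : set (measurableTypeR R)) /\ mu (A i) = 0%E) ->
  mu.-negligible (\bigcup_(i in [set: I]) A i).
Proof.
move=> A0; pose B n := oapp A set0 (unpickle n).
suff : mu.-negligible (\bigcup_n B n).
  by apply: negligibleS => x [i _ Aix]; exists (pickle i) => //; rewrite /B pickleK.
apply: negligible_bigcup => n; rewrite /B.
case: unpickle => [i|] /=; last exact: negligible_set0.
by apply/negligibleP; case: (A0 i).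
Qed.

(** Frechet subgradient: a lower bound only, but for [h] of both signs. *)
Definition subdiff f t l := forall k, 0 < k -> exists2 d, 0 < d &
  forall h, `|h| < d -> f t + l * h - k * `|h| <= f (t + h).

(** [l] is the upper left Dini derivative, the supremum of the [r] with [dini_up f r t]. If the
    lower right one were smaller, two rationals between them would form a gap. *)
Lemma subdiff_exists f t :
  ~ (exists q q' : rat, q < q' /\
      dini_low f (ratr q) t /\ dini_up f (ratr q') t) ->
  ~ (forall n : nat, dini_low f (- n%:R) t) ->
  ~ (forall n : nat, dini_up f n%:R t) ->
  exists l, subdiff f t l.
Proof.
move=> gap /existsNP[n nlow] /existsNP[p pup].
have low_le r r' : r <= r' -> dini_low f r t -> dini_low f r' t.
  move=> rr' /dini_lowP H; apply/dini_lowP => e /H[h hI fh]; exists h => //.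
  by apply: lt_le_trans fh _; rewrite ler_wpM2r//; lra.
have up_le r r' : r <= r' -> dini_up f r' t -> dini_up f r t.
  move=> rr' /dini_upP H; apply/dini_upP => e /H[h hI fh]; exists h => //.
  by apply: le_lt_trans fh; rewrite ler_wpM2r//; lra.
have up_lt r : dini_up f r t -> r < p%:R.
  by move=> rt; rewrite ltNge; apply/negP => /up_le/(_ rt).
suff [l lP] : exists l, forall k, 0 < k ->
    ~ dini_low f (l - k) t /\ ~ dini_up f (l + k) t.
  exists l => k k0; have [nl nu] := lP k k0.
  have [d d0 dP] : exists2 d, 0 < d & forall h, 0 < h < d ->
      (l - k) * h <= f (t + h) - f t.
    apply: contrapT => H; apply: nl; apply/dini_lowP => e e0.
    apply: contrapT => H'; apply: H; exists e => // h hI.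
    by rewrite leNgt; apply/negP => H''; apply: H'; exists h.
  have [d' d'0 d'P] : exists2 d, 0 < d & forall h, 0 < h < d ->
      f t - f (t - h) <= (l + k) * h.
    apply: contrapT => H; apply: nu; apply/dini_upP => e e0.
    apply: contrapT => H'; apply: H; exists e => // h hI.
    by rewrite leNgt; apply/negP => H''; apply: H'; exists h.
  exists (Num.min d d'); first by rewrite lt_min d0.
  move=> h; rewrite lt_min => /andP[hd hd'].
  have [h0|h0|->] := ltgtP h 0; last by rewrite normr0 !addr0 !mulr0; lra.
  - move: hd hd'; rewrite ltr0_norm// => hd hd'.
    by have := d'P (- h) ltac:(lra); rewrite opprK; lra.
  - move: hd hd'; rewrite gtr0_norm// => hd hd'.
    by have := dP h ltac:(lra); lra.
pose M := [set r | dini_up f r t].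
have [M0|/nonemptyPn M0] := pselect (M !=set0); last first.
  (* If [M] is empty, the left side imposes nothing, and any [l] not above the lower right
     derivative will do. *)
  exists (- n%:R) => k k0; split; first by move/low_le => H; apply/nlow/H; lra.
  by move=> H; have : M (- n%:R + k) by []; rewrite M0.
have supM : has_sup M by split => //; exists p%:R => r /up_lt/ltW.
exists (sup M) => k k0; split; last first.
  by move=> H; have := ub_le_sup supM.2 H; lra.
move=> H; have [r Mr kr] := sup_adherent k0 supM.
have [q /andP[q1 q2]] : exists q : rat, sup M - k < ratr q < r.
  by have [q] := rat_in_itvoo kr; rewrite in_itv/=; exists q.
have [q' /andP[q'1 q'2]] : exists q' : rat, (ratr q : R) < ratr q' < r.
  by have [q'] := rat_in_itvoo q2; rewrite in_itv/=; exists q'.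
apply: gap; exists q, q'; split; first by rewrite -(ltr_rat R).
by split; [apply: low_le H; lra|apply: up_le Mr; lra].
Qed.

Lemma measurable_dini_low_infty f : continuous f ->
  measurable (\bigcap_(n in [set: nat]) dini_low f (- n%:R) : set (measurableTypeR R)).
Proof.
move=> cf; apply: (bigcapT_measurable (F := fun n => dini_low f (- n%:R))) => n.
exact: measurable_dini_low.
Qed.

Lemma measurable_dini_up_infty f : continuous f ->
  measurable (\bigcap_(n in [set: nat]) dini_up f n%:R : set (measurableTypeR R)).
Proof.
move=> cf; apply: (bigcapT_measurable (F := fun n => dini_up f n%:R)) => n.
exact: measurable_dini_up.
Qed.

(** Countably many intervals around rationals, of length at most [d / 2], cover []a, b[]. *)
Lemma locally_null E a b : measurable (E : set (measurableTypeR R)) ->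
  (exists2 d, 0 < d & forall c c', a <= c -> c' <= b -> c' - c < d ->
    mu (E `&` `]c, c'[) = 0%E) -> mu.-negligible (E `&` `]a, b[).
Proof.
move=> mE [d d0 dP].
pose A (q : rat) := E `&`
  `]Num.max a (ratr q - d / 4), Num.min b (ratr q + d / 4)[.
suff : mu.-negligible (\bigcup_(q in [set: rat]) A q).
  apply: negligibleS.
  move=> x [Ex]; rewrite /= in_itv/= => xI.
  have [q qI] : exists q : rat, x - d / 4 < ratr q < x + d / 4.
    have [|q] := @rat_in_itvoo R (x - d / 4) (x + d / 4); first by lra.
    by rewrite in_itv/=; exists q.
  exists q => //; split => //.
  by rewrite /= in_itv/= gt_max lt_min; lra.
apply: countable_bigcup_null => q; split; first exact: measurableI.
apply: dP.
- by rewrite le_max lexx.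
- by rewrite ge_min lexx.
- have : Num.min b (ratr q + d / 4) <= ratr q + d / 4 by rewrite ge_min lexx orbT.
  have : ratr q - d / 4 <= Num.max a (ratr q - d / 4) by rewrite le_max lexx orbT.
  lra.
Qed.

(** A bad point has a gap between two rationals, a lower right derivative equal to minus infinity,
    or an upper left one equal to plus infinity. The gaps form a countable union; the other two sets
    are locally null. *)
Lemma ac_subdiff_ae f a b : continuous f -> ac f a b ->
  mu.-negligible [set t | a < t < b /\ ~ exists l, subdiff f t l].
Proof.
move=> cf acf.
pose Gap (q : rat * rat) := if q.1 < q.2 then
  dini_low f (ratr q.1) `&` dini_up f (ratr q.2) `&` `]a, b[ else set0.
pose Low := \bigcap_(n in [set: nat]) dini_low f (- n%:R).
pose Up := \bigcap_(n in [set: nat]) dini_up f n%:R.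
suff : mu.-negligible ((\bigcup_(q in [set: rat * rat]) Gap q) `|`
    ((Low `&` `]a, b[) `|` (Up `&` `]a, b[))).
  apply: negligibleS.
  move=> t [tI nl]; apply: contrapT => H; apply: nl; apply: subdiff_exists.
  - move=> [q [q' [qq' [H1 H2]]]]; apply: H; left; exists (q, q') => //.
    by rewrite /Gap qq'; split => //=; rewrite in_itv.
  - move=> H'; apply: H; right; left; split; first by move=> n _; exact: H'.
    by rewrite /= in_itv.
  - move=> H'; apply: H; right; right; split; first by move=> n _; exact: H'.
    by rewrite /= in_itv.
apply: negligibleU; last apply: negligibleU.
- apply: countable_bigcup_null => -[q q']; rewrite /Gap/=; case: ifPn => qq'.
    split; last by apply: dini_gap_null; rewrite ?ltr_rat.
    apply: measurableI => //; apply: measurableI.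
      exact: measurable_dini_low.
    exact: measurable_dini_up.
  by split => //; exact: measure0.
- have mL := measurable_dini_low_infty cf.
  apply: locally_null => //; apply: (infinite_dini_null cf) => //.
  by left => n; exact: bigcap_inf.
- have mL := measurable_dini_up_infty cf.
  apply: locally_null => //; apply: (infinite_dini_null cf) => //.
  by right => n; exact: bigcap_inf.
Qed.

End Subdifferential.

(** * Monotone majorant for an integrable rate *)

Section Majorant.
Set Implicit Arguments. Unset Strict Implicit.
Context {R : realType}.
Notation mu := (@lebesgue_measure R).
Notation Rc := (caratheodory_type (wlength (R := R) idfun)^*%mu).

Lemma sum_lt_indicator (x : R) (N : nat) : 0 <= x ->
  \sum_(0 <= j < N) (if j%:R < x then 1 else 0) <= x + 1.
Proof.
move=> x0; set s := BIG_F; rewrite -/s.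
(* The induction also carries the bound by [N]: when [N < x], the new term is covered by
   [N + 1 <= x + 1]. *)
suff : \sum_(0 <= j < N) s j <= N%:R /\ \sum_(0 <= j < N) s j <= x + 1 by case.
elim: N => [|N [IH1 IH2]]; first by rewrite big_geq//; split => //; lra.
rewrite big_nat_recr//= -natr1 /s; case: ifPn => [Nx|_]; last by split; lra.
by split; lra.
Qed.

(** Layer cake: the indicators of the sets [k > j] sum to at most [k + 1], which is integrable over
    a bounded interval. *)
Lemma layers_summable (k : R -> R) (T : R) : 0 <= T ->
  (forall t, 0 <= t <= T -> 0 <= k t) ->
  leb.-integrable `[0, T] (EFin \o k) ->
  (\sum_(0 <= j <oo) leb ([set t | (0 <= t <= T)%R /\ (j%:R < k t)%R] : set Rc)
    < +oo)%E.
Proof.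
move=> T0 k0 ik.
pose D : set Rc := `[0, T]%classic.
have mD : measurable (D : set Rc).
  apply: sub_caratheodory; exact: (measurable_itv `[0, T]).
have mk := measurable_int _ ik.
pose A (j : nat) : set Rc := [set t | 0 <= t <= T /\ j%:R < k t].
have mA j : measurable (A j).
  rewrite (_ : A j = D `&` (EFin \o k) @^-1` `]j%:R%:E, +oo[); last first.
    by apply/seteqP; split => t; rewrite /A/D/= !in_itv/= lte_fin andbT.
  by apply: mk => //; exact: emeasurable_itv.
have finD : (leb D < +oo)%E.
  have -> : leb D = mu D by [].
  by rewrite /D lebesgue_measure_itv/=; case: ifP => // _; rewrite -EFinB ltry.
pose B := (\int[leb]_(t in D) (EFin \o k) t +
   \int[leb]_(t in D) 1)%E.
have Boo : (B < +oo)%E.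
  rewrite /B lte_add_pinfty//.
    have := (integrableP _ _ _ ik).2; congr (_ < _)%E; apply: eq_integral => t.
    by rewrite inE/= in_itv/= => /k0 kt; rewrite ger0_norm.
  by rewrite integral_cst//= mul1e.
apply: le_lt_trans Boo.
apply: lime_le; first by apply: is_cvg_nneseries => *; exact: measure_ge0.
apply: nearW => N.
rewrite (eq_bigr (fun j => \int[leb]_(t in D) (\1_(A j) t)%:E)%E); last first.
  move=> j _; rewrite integral_indic//; congr (leb _).
  by apply/seteqP; split => [t [tI kt]|t []//]; split => //=; rewrite in_itv.
have mI j : measurable_fun D (EFin \o \1_(A j) : Rc -> \bar R).
  by apply/measurable_EFinP; exact: measurable_indic.
have I0 j t : D t -> (0 <= (EFin \o \1_(A j) : Rc -> \bar R) t)%E.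
  by rewrite lee_fin.
rewrite -(ge0_integral_sum leb mD mI I0).
have kD t : D t -> 0 <= k t by rewrite /D/= in_itv/= => /k0.
rewrite /B -ge0_integralD//.
apply: ge0_le_integral.
- exact: mD.
- by move=> t _; apply: sume_ge0 => j _; rewrite lee_fin.
- by apply: emeasurable_sum => j; exact: mI.
- exact: emeasurable_funD.
- move=> t Dt; rewrite sumEFin -EFinD lee_fin.
  apply: le_trans (sum_lt_indicator N (kD t Dt)).
  apply: ler_sum => j _; rewrite indicE; case: ifPn => jk.
    by rewrite lern1 leq_b1.
  by rewrite memNset// => -[_ jk']; rewrite jk' in jk.
Qed.

Lemma ball_open_finite (U : nat -> set R) t m :
  (forall j, open (U j)) -> (forall j, (j < m)%N -> U j t) ->
  exists2 d, 0 < d & forall j x, (j < m)%N -> `|t - x| < d -> U j x.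
Proof.
move=> oU; elim: m => [|m IH] Ut; first by exists 1.
have [|d d0 dU] := IH; first by move=> j jm; apply: Ut; exact: ltnW.
have := oU m; rewrite openE => /(_ t (Ut m (ltnSn m)))[e /= e0 eU].
exists (Num.min d e); first by rewrite lt_min d0.
move=> j x; rewrite lt_min ltnS leq_eqVlt => /predU1P[->|jm] /andP[xd xe].
  exact: eU.
exact: dU.
Qed.

(* [K t] sums over [j] the measure of the part of [U_j] left of [t], where the
   open set [U_j] contains [{k > j}] and is little larger. This gives a lower
   bound on the increments of [K] at every point [t], not just almost everywhere,
   and [K] need not be absolutely continuous. *)
Lemma monotone_majorant (k : R -> R) (T : R) : 0 <= T ->
  (forall t, 0 <= t <= T -> 0 <= k t) ->
  leb.-integrable `[0, T] (EFin \o k) ->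
  exists2 K : R -> R, {homo K : x y / x <= y} & forall t, 0 <= t <= T ->
    exists2 d, 0 < d & forall s, t - d < s < t -> k t * (t - s) <= K t - K s.
Proof.
move=> T0 k0 ik; pose A (j : nat) : set Rc := [set t | (0 <= t <= T)%R /\ (j%:R < k t)%R].
have Aoo : (\sum_(0 <= j <oo) leb (A j) < +oo)%E := layers_summable T0 k0 ik.
(* Tolerances with sum 1 keep the total measure of the [U j] finite. *)
have e0 j : 0 < 1 / (2 ^ j.+1)%:R :> R by rewrite divr_gt0// ltr0n expn_gt0.
have /choice[U UP] j : exists U : set R,
    [/\ open U, A j `<=` U & (mu U <= leb (A j) + (1 / (2 ^ j.+1)%:R)%:E)%E].
  exact: outer_measure_open_le.
have oU j : open (U j) by have [] := UP j.
have mU j : measurable (U j : set (measurableTypeR R)) by exact: open_measurable.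
have Uoo : (\sum_(0 <= j <oo) mu (U j) < +oo)%E.
  apply: (@le_lt_trans _ _ (\sum_(0 <= j <oo) leb (A j) + 1)%E); last first.
    by rewrite lte_add_pinfty// ltry.
  apply: le_trans (epsilon_trick xpredT (fun j => measure_ge0 leb (A j)) ler01).
  by apply: lee_nneseries => // j _; have [] := UP j.
pose G t := (\sum_(0 <= j <oo) mu (U j `&` `]-oo, t]))%E.
have Gfin t : G t \is a fin_num.
  rewrite ge0_fin_numE; last by apply: nneseries_ge0.
  apply: le_lt_trans Uoo; apply: lee_nneseries => // j _.
  by apply: le_measure; rewrite ?inE//; exact: measurableI.
pose D s t := (\sum_(0 <= j <oo) mu (U j `&` `]s, t]))%E.
have GD s t : s <= t -> G t = (G s + D s t)%E.
  move=> st; rewrite /G /D -nneseriesD//; apply: eq_eseriesr => j _.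
  rewrite -measureU//=; last 3 first.
  - exact: measurableI.
  - exact: measurableI.
  - rewrite -subset0 => x [[_]]; rewrite /= in_itv/= => xt [_]; rewrite /= in_itv/=; lra.
  congr (mu _); apply/seteqP; split => [x [Ux]|x [] [Ux]]; rewrite /= ?in_itv/=.
  - by move=> xs; have [xt|tx] := leP x s; [left|right]; split; rewrite //= ?in_itv/= ?tx.
  - by move=> xt; split => //=; rewrite ?in_itv/=; lra.
  - by move=> xt; split => //=; rewrite ?in_itv/=; lra.
have Dge0 s t : (0 <= D s t)%E by apply: nneseries_ge0.
exists (fine \o G) => [s t st /=|t tI].
  by rewrite fine_le// (GD _ _ st) leeDl.
(* [m] is the ceiling of [k t], so [t] lies in exactly the first [m] layers. For [s] close to [t]
   the corresponding [U j] contain []s, t]], and [K] grows there at rate at least [m]. *)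
have [m mk mmin] : exists2 m : nat, k t <= m%:R & forall j, (j < m)%N -> j%:R < k t.
  have ex : exists m : nat, k t <= m%:R.
    by exists (Num.bound (k t)); apply/ltW/archi_boundP/k0.
  case: (ex_minnP ex) => m mk mmin; exists m => // j jm.
  by rewrite ltNge; apply/negP => /mmin; rewrite leqNgt jm.
have [j jm|d d0 dU] := @ball_open_finite U t m oU.
  by have [_ AU _] := UP j; apply: AU; split => //; exact: mmin.
exists d => // s sI /=.
have Dlow : ((m%:R * (t - s))%:E <= D s t)%E.
  apply: (@le_trans _ _ (\sum_(0 <= j < m) mu (U j `&` `]s, t]))%E); last first.
    exact: nneseries_lim_ge.
  rewrite (eq_big_nat _ _ (F2 := fun=> (t - s)%:E)); last first.
    move=> j /= jm; rewrite -lebesgue_itvoc_length; last by lra.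
    congr (mu _); apply/seteqP; split => [x []//|x xI]; split => //.
    by apply: (dU j) => //; move: xI; rewrite /= in_itv/= ltr_norml; lra.
  by rewrite sumEFin sumr_const_nat subn0 mulr_natl.
have Dfin : D s t \is a fin_num.
  have := Gfin t; rewrite (GD s t); last by lra.
  by rewrite fin_numD => /andP[].
rewrite (GD s t) ?fineD//; last by lra.
move: Dlow; rewrite -(fineK Dfin) lee_fin => Dlow.
have : k t * (t - s) <= m%:R * (t - s) by rewrite ler_wpM2r//; lra.
lra.
Qed.


End Majorant.

(** * Euclidean geometry of row vectors *)

Section Euclid.
Set Implicit Arguments. Unset Strict Implicit.
Context {R : realType} {m : nat}.
Implicit Types (u v w : 'rV[R]_m).

Definition dot u v : R := \sum_i u 0 i * v 0 i.

Lemma dotC u v : dot u v = dot v u.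
Proof. by apply: eq_bigr => i _; rewrite mulrC. Qed.

Lemma dotDr u v w : dot u (v + w) = dot u v + dot u w.
Proof. by rewrite -big_split; apply: eq_bigr => i _; rewrite mxE mulrDr. Qed.

Lemma dotZr (a : R) u v : dot u (a *: v) = a * dot u v.
Proof. by rewrite mulr_sumr; apply: eq_bigr => i _; rewrite mxE mulrCA. Qed.

Lemma dotBr u v w : dot u (v - w) = dot u v - dot u w.
Proof. by rewrite dotDr -scaleN1r dotZr mulN1r. Qed.

Lemma dotDl u v w : dot (u + v) w = dot u w + dot v w.
Proof. by rewrite dotC dotDr dotC (dotC w). Qed.

Lemma enorm_ge0 u : 0 <= enorm u. Proof. exact: sqrtr_ge0. Qed.

Lemma enorm_sqr u : enorm u ^+ 2 = dot u u.
Proof.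
rewrite sqr_sqrtr; last by apply: sumr_ge0 => i _; exact: sqr_ge0.
by apply: eq_bigr => i _; rewrite expr2.
Qed.

Lemma dot_ge0 u : 0 <= dot u u. Proof. by rewrite -enorm_sqr sqr_ge0. Qed.

Lemma enormZ (a : R) u : enorm (a *: u) = `|a| * enorm u.
Proof.
apply: (@pexpIrn _ 2); rewrite ?nnegrE ?mulr_ge0 ?enorm_ge0//.
by rewrite exprMn !enorm_sqr dotZr dotC dotZr mulrA -expr2 real_normK// num_real.
Qed.

Lemma enormN u : enorm (- u) = enorm u.
Proof. by rewrite -scaleN1r enormZ normrN1 mul1r. Qed.

Lemma enormB u v : enorm (u - v) = enorm (v - u).
Proof. by rewrite -enormN opprB. Qed.

Lemma enorm_eq0 u : enorm u = 0 -> u = 0.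
Proof.
move=> u0; have : dot u u = 0 by rewrite -enorm_sqr u0 expr0n.
move=> /eqP; rewrite psumr_eq0 => [/allP H|i _]; last by rewrite -expr2 sqr_ge0.
apply/rowP => i; rewrite mxE; apply/eqP.
by have := H i (mem_index_enum _); rewrite mulf_eq0 orbb.
Qed.

Lemma enorm0 : enorm (0 : 'rV[R]_m) = 0.
Proof. by rewrite -(scale0r (0 : 'rV[R]_m)) enormZ normr0 mul0r. Qed.

(** Cauchy-Schwarz, from the square of [|v| u - |u| v] being nonnegative. *)
Lemma dot_le u v : dot u v <= enorm u * enorm v.
Proof.
have [u0|un0] := eqVneq (enorm u) 0.
  by rewrite u0 mul0r (enorm_eq0 u0) /dot big1// => i _; rewrite mxE mul0r.
have [v0|vn0] := eqVneq (enorm v) 0.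
  by rewrite v0 mulr0 (enorm_eq0 v0) /dot big1// => i _; rewrite mxE mulr0.
have := dot_ge0 (enorm v *: u - enorm u *: v).
rewrite dotBr !dotZr !(dotC (_ - _)) !dotBr !dotZr -!enorm_sqr (dotC v u).
have := enorm_ge0 u; have := enorm_ge0 v.
rewrite !le_eqVlt ![0 == enorm _]eq_sym (negbTE un0) (negbTE vn0)/= => v_gt0 u_gt0.
move: (enorm u) (enorm v) (dot u v) u_gt0 v_gt0 => a b d a0 b0 H.
have ab0 : 0 < a * b by rewrite mulr_gt0.
have {}H : 0 <= (a * b) * (a * b - d) by case/orP: H => [/eqP|]; lra.
by move: H; rewrite pmulr_rge0// subr_ge0 le_eqVlt.
Qed.

Lemma enormD u v : enorm (u + v) <= enorm u + enorm v.
Proof.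
rewrite -(@ler_pXn2r _ 2)// ?nnegrE ?addr_ge0 ?enorm_ge0//.
rewrite enorm_sqr dotDr !dotDl sqrrD !enorm_sqr (dotC v u).
have := dot_le u v; lra.
Qed.

Lemma enorm_tri u v w : enorm (u - w) <= enorm (u - v) + enorm (v - w).
Proof. by rewrite -(subrKA v) enormD. Qed.

(* AM-GM: [2 |u| |u + v| <= |u|^2 + |u + v|^2] *)
Lemma enormD_linearize u v : 0 < enorm u ->
  enorm (u + v) <= enorm u + (dot u v + enorm v ^+ 2 / 2) / enorm u.
Proof.
move=> u0; have := sqr_ge0 (enorm (u + v) - enorm u).
have : enorm (u + v) ^+ 2 = enorm u ^+ 2 + 2 * dot u v + enorm v ^+ 2.
  by rewrite !enorm_sqr dotDr !dotDl (dotC v u); lra.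
move=> e H; rewrite -lerBlDl ler_pdivlMr//.
move: (enorm u) (enorm v) (enorm _) (dot u v) e H => x y z d e H.
by nra.
Qed.

Lemma continuous_dot u : continuous (dot u).
Proof.
have H i : continuous (fun v : 'rV[R]_m => u 0 i * v 0 i).
  move=> v; apply: (@continuous_comp _ _ _ (fun v : 'rV[R]_m => v 0 i) ( *%R (u 0 i))).
    exact: coord_continuous.
  exact: mulrl_continuous.
move=> v; apply: (@cvg_big _ _ +%R 0 xpredT (@add_continuous _) _ (nbhs v)
  (index_enum 'I_m) (fun i v => u 0 i * v 0 i) (fun i => u 0 i * v 0 i)).
by move=> i _; exact: H.
Qed.

Lemma continuous_enorm : continuous (@enorm R m).
Proof.
have H i : continuous (fun v : 'rV[R]_m => v 0 i ^+ 2).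
  move=> v; apply: (@continuous_comp _ _ _ (fun v : 'rV[R]_m => v 0 i) (fun x : R => x ^+ 2)).
    exact: coord_continuous.
  exact: exprn_continuous.
move=> v; apply: continuous_comp; last exact: sqrt_continuous.
apply: (@cvg_big _ _ +%R 0 xpredT (@add_continuous _) _ (nbhs v)
  (index_enum 'I_m) (fun i v => v 0 i ^+ 2) (fun i => v 0 i ^+ 2)).
by move=> i _; exact: H.
Qed.

(** The ball is a closed subset of a product of segments. *)
Lemma compact_cball (r : R) : compact (@cball R m r).
Proof.
pose Q := [set v : 'rV[R]_m | forall i, `[- r, r]%classic (v 0 i)].
apply: (@subclosed_compact _ _ Q).
- apply: (@closed_comp _ _ (@enorm R m) [set x | x <= r]); last exact: closed_le.
  by move=> v _; exact: continuous_enorm.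
- by apply: (@rV_compact R m (fun=> `[- r, r]%classic)) => _; exact: segment_compact.
- move=> v vr i; rewrite /= in_itv/= -ler_norml; apply: le_trans vr.
  rewrite -sqrtr_sqr ler_wsqrtr// (bigD1 i)//= lerDl.
  by apply: sumr_ge0 => j _; exact: sqr_ge0.
Qed.

(** Only points no farther than a given [s] of [S] matter; they form a compact set, on which the
    minimum exists. *)
Lemma nearest_point (S : set 'rV[R]_m) u : closed S -> S !=set0 ->
  exists2 v, S v & forall w, S w -> enorm (u - v) <= enorm (u - w).
Proof.
move=> cS [s Ss].
pose B := [set v | enorm (u - v) <= enorm (u - s)].
have cN : continuous (fun v => enorm (u - v)).
  move=> v; apply: continuous_comp; last exact: continuous_enorm.
  exact: (@cvgB _ _ _ (nbhs v) _ (fun=> u) id u v (cvg_cst u) cvg_id).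
have cB : closed B.
  apply: (@closed_comp _ _ (fun v => enorm (u - v)) [set x | x <= enorm (u - s)]).
    by move=> v _; exact: cN.
  exact: closed_le.
have : compact (S `&` B).
  apply: (@subclosed_compact _ _ (cball (enorm u + enorm (u - s)))).
  - exact: closedI.
  - exact: compact_cball.
  - move=> v [_ Bv]; rewrite /cball/= -(subKr u v) addrC (le_trans (enormD _ _))//.
    by rewrite enormN addrC lerD2l.
move=> /(@compact_EVT_min _ R (fun v => enorm (u - v)))[].
- by exists s; split => //; rewrite /B/=.
- by apply: continuous_subspaceT.
- move=> v; rewrite inE => -[Sv Bv] H; exists v => // w Sw.
  have [Bw|nBw] := pselect (B w); first by apply: H; rewrite inE.
  by apply: le_trans Bv _; move/negP: nBw; rewrite -ltNge => /ltW.
Qed.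

Lemma enorm2_fst (p : R * 'rV[R]_m) : `|p.1| <= enorm2 p.
Proof.
rewrite -sqrtr_sqr ler_wsqrtr// lerDl.
by apply: sumr_ge0 => j _; exact: sqr_ge0.
Qed.

Lemma enorm2_snd (p : R * 'rV[R]_m) : enorm p.2 <= enorm2 p.
Proof. by rewrite ler_wsqrtr// lerDr sqr_ge0. Qed.

End Euclid.

(** The sharp bound is the square root of 2; the constant 2 becomes the factor in
    [l <= 2 * k * G t]. *)
Lemma cyl_enorm {R : realType} {n : nat} (c : 'rV[R]_n.+1) : cyl c -> enorm c <= 2.
Proof.
move=> [c1 c2]; rewrite -(@ler_pXn2r _ 2)// ?nnegrE ?enorm_ge0//.
rewrite /enorm sqr_sqrtr; last by apply: sumr_ge0 => j _; exact: sqr_ge0.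
rewrite (bigID (fun i : 'I_n.+1 => (i < n)%N))/=.
set s := (X in X + _ <= _).
have s0 : 0 <= s by apply: sumr_ge0 => j _; exact: sqr_ge0.
have s1 : s <= 1.
  by rewrite -(sqr_sqrtr s0) -[leRHS](expr1n _ 2) ler_pXn2r ?nnegrE ?sqrtr_ge0.
rewrite (big_pred1 ord_max) => [|i]; last first.
  by rewrite /= -leqNgt -val_eqE/= eqn_leq -[(i <= n)%N]ltnS ltn_ord.
have : c 0 ord_max ^+ 2 <= 1.
  by rewrite -(real_normK (num_real _)) -[leRHS](expr1n _ 2) ler_pXn2r ?nnegrE.
lra.
Qed.

(** * Contingent directions against a subgradient of the distance *)

Section Tangent.
Set Implicit Arguments. Unset Strict Implicit.
Context {R : realType} {m : nat}.
Implicit Types (z : R -> 'rV[R]_m) (q v w y : 'rV[R]_m).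

Lemma derivable_expand z t : derivable z t 1 -> forall k, 0 < k ->
  exists2 d, 0 < d & forall s, `|s| < d ->
    enorm (z (t + s) - z t - s *: 'D_1 z t) <= k * `|s|.
Proof.
move=> dz k k0.
have zD : h^-1 *: (z (h *: (1 : R) + t) - z t) @[h --> 0^'] --> 'D_1 z t by exact: dz.
pose D : 'rV[R]_m := 'D_1 z t.
have cN : {for D, continuous (fun x : 'rV[R]_m => enorm (x - D))}.
  apply: continuous_comp; last exact: continuous_enorm.
  exact: (@cvgB _ _ _ (nbhs D) _ id (fun=> D) D D cvg_id (cvg_cst D)).
have := cvg_comp _ _ zD cN => /=; rewrite /= subrr enorm0.
move/cvgrPdist_lt => /(_ k k0).
rewrite near_withinE near_nbhs => -[d /= d0 dP]; exists d => // s sd.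
have [->|sn0] := eqVneq s 0.
  by rewrite addr0 subrr scale0r subr0 enorm0 normr0 mulr0.
have /= := dP s; rewrite /ball_/= !sub0r !normrN => /(_ sd sn0).
rewrite ger0_norm ?enorm_ge0// => /ltW H.
rewrite [X in enorm X](_ : _ = s *: (s^-1 *: (z (s *: 1 + t) - z t) - D)).
  by rewrite enormZ mulrC ler_wpM2r.
by rewrite scalerBr scalerA mulfV// scale1r [s *: 1]mulr1 (addrC s).
Qed.

(** The half-space is closed and convex, hence one of the sets whose intersection is [clconv K]. *)
Lemma clconv_halfspace (K : set (R * 'rV[R]_m)) (c : R) q :
  K `<=` [set p | p.1 * c + dot q p.2 <= 0] ->
  clconv K `<=` [set p | p.1 * c + dot q p.2 <= 0].
Proof.
move=> KH p; apply; split; last split=> //.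
  apply: (@closed_comp _ _ (fun p : R * 'rV[R]_m => p.1 * c + dot q p.2)
    [set x | x <= 0]); last exact: closed_le.
  move=> x _; apply: (@cvgD _ _ _ (nbhs x) _ (fun p => p.1 * c) (fun p => dot q p.2)).
    apply: (@cvgM _ _ (nbhs x) _ (fun p => p.1) (fun=> c)); first exact: cvg_fst.
    exact: cvg_cst.
  apply: (@continuous_comp _ _ _ snd (dot q)); first exact: cvg_snd.
  exact: continuous_dot.
move=> x y l /= Hx Hy /andP[l0 l1]; rewrite dotDr !dotZr.
have := mulr_ge0_le0 l0 Hx.
have := @mulr_ge0_le0 _ (1 - l) _ ltac:(lra) Hy.
lra.
Qed.

(** With [D = g t], a graph point [(t + s, y')] near [(t, y) + x (a, v)] gives [D + l s - k |s| <= g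
    (t + s) <= |z (t + s) - y'|], and the right side is at most [D + x <q, u> / D] up to [o(x)]. As
    [s] is close to [x a], division by [x] concludes. *)
Lemma tangent_halfspace (T t l : R) z (P : R -> set 'rV[R]_m) (g : R -> R) y w :
  (exists2 r, 0 < r & forall s, `|s - t| < r -> forall x, P s x -> g s <= enorm (z s - x)) ->
  subdiff g t l ->
  (forall k, 0 < k -> exists2 d, 0 < d & forall s, `|s| < d ->
    enorm (z (t + s) - z t - s *: w) <= k * `|s|) ->
  g t = enorm (z t - y) -> 0 < g t ->
  forall p, tcone (gph T P) (t, y) p ->
    p.1 * l * g t <= dot (z t - y) (p.1 *: w - p.2).
Proof.
move=> [r r0 gr] gl zw gt g0 [a v] /= tc.
set q := z t - y; set u := a *: w - v.
set D := g t.
apply/ler_addgt0Pr => e e0.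
(* [C] collects all that multiplies [k x] once the estimate is multiplied by [D]; [k] is then chosen
   with [k C <= e]. *)
pose C := enorm u ^+ 2 / 2 + D * (`|l| + 2 * `|a| + 3 + enorm w).
have C0 : 0 <= C.
  rewrite /C addr_ge0 ?divr_ge0 ?sqr_ge0 ?mulr_ge0 ?(ltW g0)//.
  by have := enorm_ge0 w; have := normr_ge0 l; have := normr_ge0 a; lra.
pose k := Num.min 1 (e / (C + 1)).
have k0 : 0 < k by rewrite lt_min ltr01 divr_gt0//; lra.
have k1 : k <= 1 by rewrite ge_min lexx.
have kC : k * C <= e.
  have : k <= e / (C + 1) by rewrite ge_min lexx orbT.
  by rewrite ler_pdivlMr; lra.
have [r1 r10 gl1] := gl k k0.
have [r2 r20 zw2] := zw k k0.
pose a1 := `|a| + 1.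
have a10 : 0 < a1 by rewrite /a1; have := normr_ge0 a; lra.
pose rr := Num.min r (Num.min r1 r2).
have rr0 : 0 < rr by rewrite !lt_min r0 r10.
(* [x <= k] makes the quadratic term an error of order [k x]; [x a1 < rr] keeps [s], bounded by
   [x a1], where all three local estimates hold. *)
pose dl := Num.min k (rr / a1).
have dl0 : 0 < dl by rewrite lt_min k0 divr_gt0.
have [x [/andP[x0 xdl] [[t' y'] [[_ Py'] /=]]]] := tc k dl k0 dl0.
rewrite /= in Py' *.
set E2 := (X in enorm2 X) => xE.
pose s := t' - t.
have e1 : `|x * a - s| <= k * x.
  have -> : x * a - s = t + x * a - t' by rewrite /s; lra.
  by have := enorm2_fst E2; rewrite /E2/=; lra.
have e2 : enorm (y + x *: v - y') <= k * x.
  by have := enorm2_snd E2; rewrite /E2/=; lra.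
have xk : x <= k by apply: le_trans (ltW xdl) _; rewrite ge_min lexx.
have xa : x * a1 < rr.
  have : x < rr / a1 by apply: lt_le_trans xdl _; rewrite ge_min lexx orbT.
  by rewrite ltr_pdivlMr.
have sle : `|s| <= x * a1.
  have : `|s| <= `|x * a| + `|x * a - s|.
    by rewrite -{1}(subKr (x * a) s) (le_trans (ler_normB _ _)).
  rewrite normrM (gtr0_norm x0) /a1; nra.
move: xa; rewrite /rr !lt_min => /andP[xr /andP[xr1 xr2]].
have t'E : t' = t + s by rewrite /s; lra.
have H1 := gl1 s (le_lt_trans sle xr1).
have H2 := zw2 s (le_lt_trans sle xr2).
have H3 := gr t' (le_lt_trans sle xr) y' Py'.
rewrite -t'E in H1 H2.
(* Main term [q + x u], then the remainder of [z], the time error times [w], and the error in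
   [y']. *)
have zy : z t' - y' = (q + x *: u) +
    ((z t' - z t - s *: w) + ((s - x * a) *: w + (y + x *: v - y'))).
  rewrite /q /u; clearbody s; apply/rowP => i; rewrite !mxE; ring.
have H4 : enorm (z t' - y') <= enorm (q + x *: u) + (k * `|s| + (k * x * enorm w + k * x)).
  rewrite zy (le_trans (enormD _ _))// lerD2l (le_trans (enormD _ _))// lerD//.
  rewrite (le_trans (enormD _ _))// lerD// enormZ ler_wpM2r ?enorm_ge0//.
  by rewrite distrC.
have qD : enorm q = D by rewrite /D gt.
have H5 : enorm (q + x *: u) <= D + (x * dot q u + (x * enorm u) ^+ 2 / 2) / D.
  have : 0 < enorm q by rewrite qD.
  by move=> /(enormD_linearize (x *: u)); rewrite dotZr enormZ gtr0_norm// qD.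
have H6 : l * (x * a) - `|l| * (k * x) <= l * s.
  have : `|l * (x * a - s)| <= `|l| * (k * x) by rewrite normrM ler_wpM2l.
  by rewrite ler_norml; lra.
have H7 : k * `|s| <= k * (x * a1) by rewrite ler_wpM2l// ltW.
set Q := (X in D + X) in H5.
have H8 : l * (x * a) - `|l| * (k * x) - 2 * (k * (x * a1)) - (k * x * enorm w + k * x) <= Q.
  rewrite -/D in H1; lra.
move: H8; rewrite /Q ler_pdivlMr// => H8.
rewrite -(ler_pM2l x0).
have xxk : x * x * (enorm u ^+ 2 / 2) <= x * k * (enorm u ^+ 2 / 2).
  by rewrite ler_wpM2r ?divr_ge0 ?sqr_ge0// ler_wpM2l// ltW.
have xkC : x * (k * C) <= x * e by rewrite ler_wpM2l// ltW.
move: H8 xxk xkC; rewrite /C /a1.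
lra.
Qed.

End Tangent.

(** * Extension to the line, and families of intervals in indexed form *)

Section Clamp.
Set Implicit Arguments. Unset Strict Implicit.
Context {R : realType}.
Implicit Types (f g : R -> R) (a b t S L : R).

Lemma ac_ext f g a b : {in `[a, b], f =1 g} -> ac f a b -> ac g a b.
Proof.
move=> fg acf e e0; have [d d0 dP] := acf e e0; exists d => // S L H; apply: dP.
suff : forall t, fam setT g a t S L -> t <= b -> fam setT f a t S L by apply.
move=> t; elim=> {t S L H} [t at_ _|t S L u v w H IH tu uv vw _ wb].
  exact: fam_nil.
have at_ := fam_ge H.
rewrite -!fg ?in_itv/=; [|lra|lra].
have tb : t <= b by lra.
exact: fam_cons (IH tb) tu uv vw (@subsetT _ _).
Qed.

Lemma ac_unif_continuous f a b e : ac f a b -> 0 < e -> exists2 d, 0 < d &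
  forall t s, a <= t <= b -> a <= s <= b -> `|t - s| < d -> `|f t - f s| <= e.
Proof.
move=> acf e0; have [d d0 dP] := acf e e0; exists d => // t s.
wlog ts : t s / t <= s.
  move=> H tI sI tsd; have [/H|/ltW/H] := leP t s; first exact.
  by rewrite distrC [X in _ -> _ -> _ -> X <= _]distrC; apply=> //; rewrite distrC.
have [->|nts] := eqVneq t s; first by rewrite !subrr normr0 => *; exact: ltW.
move=> tI sI; rewrite distrC ger0_norm ?subr_ge0// => tsd.
have st : t < s by rewrite lt_neqAle nts.
have H : fam setT f a b `|f s - f t| (s - t).
  rewrite -[X in fam _ _ _ _ X](add0r _) -[X in fam _ _ _ _ _ X](add0r _).
  by apply: (@fam_cons _ setT f a t 0 0) => //; [apply: fam_nil; lra|lra].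
by rewrite (distrC (f t)); exact: dP H tsd.
Qed.

Definition clamp a b t := Num.max a (Num.min b t).

Lemma clampE a b t : a <= t <= b -> clamp a b t = t.
Proof. by move=> /andP[at_ tb]; rewrite /clamp min_r// max_r. Qed.

Lemma clamp_in a b t : a <= b -> a <= clamp a b t <= b.
Proof. by move=> ab; rewrite /clamp le_max lexx ge_max ab ge_min lexx. Qed.

Lemma clamp_lip a b t s : a <= b -> `|clamp a b t - clamp a b s| <= `|t - s|.
Proof.
move=> ab; have h1 := ler_norm (t - s); have := ler_norm (s - t).
rewrite distrC => h2; rewrite ler_norml /clamp.
by case: (leP b t); case: (leP b s); case: (leP a b); case: (leP a t); case: (leP a s); lra.
Qed.

(** The comparison lemmas ask for continuity on the whole line; constant extension beyond both ends
    provides it. *)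
Lemma ac_clamp f a b : a <= b -> ac f a b ->
  ac (f \o clamp a b) a b /\ continuous (f \o clamp a b).
Proof.
move=> ab acf; split.
  by apply: ac_ext acf => t; rewrite in_itv/= => tI; rewrite clampE.
move=> t; apply/cvgrPdist_le => e e0.
have [d d0 dP] := ac_unif_continuous acf e0.
exists d => //= s ts; apply: dP; rewrite ?clamp_in//.
exact: le_lt_trans (clamp_lip _ _ ab) ts.
Qed.

(** Passage to the indexed families of [sv_abs_cont] and [abs_cont_on]; the last interval gets index
    [ord_max]. *)
Lemma fam_family f a b S L : fam setT f a b S L ->
  exists (n : nat) (u v : 'I_n -> R),
    [/\ forall i, a <= u i /\ u i < v i /\ v i <= b, disjoint_family u v,
     \sum_(i < n) (v i - u i) = L & \sum_(i < n) `|f (v i) - f (u i)| = S].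
Proof.
elim=> {b S L} [t at_|t S L u v w H [n [u0 [v0 [I D sL sS]]]] tu uv vw _].
  by exists 0%N, (fun=> 0), (fun=> 0); split; rewrite ?big_ord0//; case.
pose ext x0 (x : R) (i : 'I_n.+1) := if unlift ord_max i is Some j then x0 j else x.
have at_ := fam_ge H.
exists n.+1, (ext u0 u), (ext v0 v); split.
- move=> i; rewrite /ext; case: unliftP => [j _|_]; last by lra.
  by have [? [? ?]] := I j; lra.
- move=> i j; rewrite /ext.
  case: unliftP => [i' ->|->]; case: unliftP => [j' ->|->] ij.
  + by apply: D; apply: contra_neq ij => ->.
  + have [? [? ?]] := I i'; rewrite -subset0 => x /= []; lra.
  + have [? [? ?]] := I j'; rewrite -subset0 => x /= []; lra.
  + by rewrite eqxx in ij.
- rewrite (bigD1_ord ord_max)//= /ext unlift_none addrC; congr (_ + _).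
  by rewrite -sL; apply: eq_bigr => i _; rewrite liftK.
- rewrite (bigD1_ord ord_max)//= /ext unlift_none addrC; congr (_ + _).
  by rewrite -sS; apply: eq_bigr => i _; rewrite liftK.
Qed.

End Clamp.

(** * Distance from a moving point to a moving closed set *)

Section Distance.
Set Implicit Arguments. Unset Strict Implicit.
Context {R : realType} {m : nat}.
Implicit Types (z : R -> 'rV[R]_m) (P : R -> set 'rV[R]_m) (S K U V : set 'rV[R]_m)
  (x y u v : 'rV[R]_m).

Definition dist x S : R := inf [set enorm (x - y) | y in S].

Lemma dist_lb x S : has_lbound [set enorm (x - y) | y in S].
Proof. by exists 0 => _ [y _ <-]; exact: enorm_ge0. Qed.

Lemma dist_le x S y : S y -> dist x S <= enorm (x - y).
Proof. by move=> Sy; apply: ge_inf; [exact: dist_lb|exists y]. Qed.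

Lemma dist_attained x S : closed S -> S !=set0 ->
  exists2 y, S y & dist x S = enorm (x - y).
Proof.
move=> cS S0; have [y Sy ymin] := nearest_point x cS S0; exists y => //.
apply/eqP; rewrite eq_le dist_le//=; apply: lb_le_inf; first by exists (enorm (x - y)), y.
by move=> _ [w Sw <-]; exact: ymin.
Qed.

Lemma dist_ge0 x S : closed S -> S !=set0 -> 0 <= dist x S.
Proof. by move=> cS S0; have [y _ ->] := dist_attained x cS S0; exact: enorm_ge0. Qed.

Lemma dK_lt K U V (e : R) : (dK K U V < e%:E)%E ->
  (forall x, U x -> K x -> exists2 u, V u & enorm (x - u) <= e) /\
  (forall x, V x -> K x -> exists2 u, U u & enorm (x - u) <= e).
Proof.
move=> /ereal_inf_lt[_ [e' [e'0 [UV VU]] <-]]; rewrite lte_fin => e'e.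
have H A B : A `&` K `<=` fatten B e' ->
    forall x, A x -> K x -> exists2 u, B u & enorm (x - u) <= e.
  move=> AB x Ax Kx; have [u [Bu [b [b1 ->]]]] := AB x (conj Ax Kx).
  exists u => //; rewrite addrAC subrr add0r enormZ ger0_norm//.
  by apply: le_trans (ltW e'e); rewrite ler_piMr.
by split; exact: H.
Qed.

Lemma dK_ge0 K U V : (0 <= dK K U V)%E.
Proof. by apply: le_ereal_inf_tmp => _ [e [e0 _] <-]; rewrite lee_fin. Qed.

(** A family of one interval; the two inclusions in [dK] serve the two orders of [t] and [s]. *)
Lemma sv_abs_cont_step (T : R) P K (e : R) : sv_abs_cont T P -> compact K -> 0 < e ->
  exists2 d, 0 < d & forall t s, 0 <= t <= T -> 0 <= s <= T -> `|t - s| < d ->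
    forall x, P t x -> K x -> exists2 u, P s u & enorm (x - u) <= e.
Proof.
move=> acP cK e0; have [d d0 dP] := acP e e0 K cK; exists d => // t s tI sI ts x Px Kx.
have H (t' s' : R) : 0 <= t' -> t' < s' -> s' <= T -> s' - t' < d ->
    (dK K (P s') (P t') < e%:E)%E.
  move=> t'0 ts' s'T ts'd.
  have := dP 1%N (fun=> t') (fun=> s'); rewrite !big_ord1; apply => //.
  by move=> i j; rewrite !ord1 eqxx.
have [st|st|ts_] := ltgtP t s; last first.
- by exists x; rewrite -?ts_// subrr enorm0 ltW.
- have [] := dK_lt (H s t _ st _ _); [lra|lra|by move: ts; rewrite ltr_norml; lra|].
  by move=> + _ => /(_ x); exact.
- have [] := dK_lt (H t s _ st _ _); [lra|lra|by move: ts; rewrite ltr_norml; lra|].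
  by move=> _ /(_ x); exact.
Qed.

Lemma abs_cont_on_step (a b : R) z (e : R) : abs_cont_on a b z -> 0 < e ->
  exists2 d, 0 < d & forall t s, a <= t <= b -> a <= s <= b -> `|t - s| < d ->
    enorm (z t - z s) <= e.
Proof.
move=> acz e0; have [d d0 dP] := acz e e0; exists d => // t s tI sI ts.
have H (t' s' : R) : a <= t' -> t' < s' -> s' <= b -> s' - t' < d ->
    enorm (z s' - z t') < e.
  move=> t'0 ts' s'T ts'd.
  have := dP 1%N (fun=> t') (fun=> s'); rewrite !big_ord1; apply => //.
  by move=> i j; rewrite !ord1 eqxx.
have [st|st|->] := ltgtP t s; last by rewrite subrr enorm0 ltW.
- by rewrite enormB; apply/ltW/H; [lra|lra|lra|move: ts; rewrite ltr_norml; lra].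
- by apply/ltW/H; [lra|lra|lra|move: ts; rewrite ltr_norml; lra].
Qed.

(** Near each [t], follow one point [y] of [P t] into the neighbouring sets; compactness of the
    interval, used as a near-covering with [M] tending to infinity, makes the bound uniform. *)
Lemma dist_bounded (t0 T : R) z P : 0 <= t0 -> sv_abs_cont T P ->
  (forall t, 0 <= t <= T -> P t !=set0 /\ closed (P t)) ->
  abs_cont_on t0 T z ->
  exists2 M, 0 < M & forall t, t0 <= t <= T ->
    enorm (z t) <= M /\ dist (z t) (P t) <= M.
Proof.
move=> t00 acP Pcl acz.
have /compact_near_coveringP := @segment_compact R t0 T.
move=> /(_ R +oo (fun M t => t0 <= t <= T -> enorm (z t) <= M /\ dist (z t) (P t) <= M) _).
case.
  move=> t; rewrite /= in_itv/= => tI.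
  have [[y Py] _] := Pcl t ltac:(lra).
  have [d d0 dP] := sv_abs_cont_step acP (@compact_cball R m (enorm y)) ltr01.
  have [d' d'0 d'P] := abs_cont_on_step acz ltr01.
  pose M0 := enorm (z t) + enorm (z t - y) + 2.
  exists ([set s | `|t - s| < Num.min d d'], [set M | M0 < M]).
    split; first by exists (Num.min d d'); rewrite //= lt_min d0.
    by exists M0; split => //; exact: num_real.
  move=> [s M] /= [+ MM] sI; rewrite lt_min => /andP[tsd tsd'].
  have [u Pu yu] := dP t s ltac:(lra) ltac:(lra) tsd y Py (lexx _).
  have zz := d'P t s tI sI tsd'.
  have zs : enorm (z s) <= enorm (z t) + 1.
    rewrite -(subrK (z t) (z s)) (le_trans (enormD _ _))// enormB.
    lra.
  split; first by have := enorm_ge0 (z t - y); rewrite /M0 in MM; lra.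
  have := dist_le (z s) Pu.
  have := enorm_tri (z s) (z t) u; have := enorm_tri (z t) y u.
  rewrite (enormB (z s) (z t)); rewrite /M0 in MM; have := enorm_ge0 (z t); lra.
move=> N [Nr NP]; exists (Num.max 1 (N + 1)); first by rewrite lt_max ltr01.
move=> t tI; apply: NP => //=; first by rewrite lt_max; lra.
Qed.

(** The point of [P t] nearest to [z t] has norm at most [M + M], so the hypothesis on the ball
    moves it into [P s]. *)
Lemma dist_step (t s M d : R) z P : closed (P t) -> P t !=set0 ->
  enorm (z t) <= M -> dist (z t) (P t) <= M ->
  (forall x, P t x -> cball (M + M) x -> exists2 u, P s u & enorm (x - u) <= d) ->
  dist (z s) (P s) <= dist (z t) (P t) + enorm (z s - z t) + d.
Proof.
move=> cP P0 zM; have [y Py ->] := dist_attained (z t) cP P0 => yM H.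
have [|u Pu yu] := H y Py.
  rewrite /cball/= -(subKr (z t) y) addrC (le_trans (enormD _ _))//.
  by rewrite enormN addrC lerD.
have := dist_le (z s) Pu.
have := enorm_tri (z s) (z t) u; have := enorm_tri (z t) y u; lra.
Qed.

Lemma dist_ac (t0 T M : R) z P : 0 <= t0 -> sv_abs_cont T P ->
  (forall t, 0 <= t <= T -> P t !=set0 /\ closed (P t)) ->
  abs_cont_on t0 T z ->
  (forall t, t0 <= t <= T -> enorm (z t) <= M /\ dist (z t) (P t) <= M) ->
  ac (fun t => dist (z t) (P t)) t0 T.
Proof.
move=> t00 acP Pcl acz zM e e0.
have e20 : 0 < e / 2 by lra.
have [d1 d10 d1P] := acP _ e20 _ (@compact_cball R m (M + M)).
have [d2 d20 d2P] := acz _ e20.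
exists (Num.min d1 d2); first by rewrite lt_min d10.
move=> S L /fam_family[n [u [v [I D <- <-]]]]; rewrite lt_min => /andP[L1 L2].
have {d2P L2} zlt := d2P n u v I D L2.
have {d1P L1} dlt : (\sum_(i < n) dK (cball (M + M)) (P (v i)) (P (u i)) < (e / 2)%:E)%E.
  by apply: d1P => // i; have [? [? ?]] := I i; lra.
pose dd i := dK (cball (M + M)) (P (v i)) (P (u i)).
have ddfin i : dd i \is a fin_num.
  rewrite ge0_fin_numE; last exact: dK_ge0.
  apply: le_lt_trans (lt_trans dlt (ltry _)); rewrite (bigD1 i)//= leeDl//.
  by apply: sume_ge0 => j _; exact: dK_ge0.
have {}dlt : \sum_(i < n) fine (dd i) < e / 2.
  rewrite -lte_fin -sumEFin; apply: le_lt_trans dlt.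
  by rewrite le_eqVlt; apply/orP; left; apply/eqP/eq_bigr => i _; rewrite fineK.
suff : forall i, `|dist (z (v i)) (P (v i)) - dist (z (u i)) (P (u i))| <=
    enorm (z (v i) - z (u i)) + fine (dd i).
  move=> H; apply: le_trans (ler_sum _ (fun i _ => H i)) _.
  by rewrite big_split/=; lra.
(* The slack [k] gives the strict inequality that [dK_lt] asks for; its two conclusions bound the
   increment from both sides. *)
move=> i; apply/ler_addgt0Pr => k k0.
have : (dd i < (fine (dd i) + k)%:E)%E by rewrite -{1}(fineK (ddfin i)) lte_fin; lra.
move=> /dK_lt[H1 H2]; have [? [? ?]] := I i.
have [Pu cu] := Pcl (u i) ltac:(lra).
have [Pv cv] := Pcl (v i) ltac:(lra).
have [zu du] := zM (u i) ltac:(lra).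
have [zv dv] := zM (v i) ltac:(lra).
have := dist_step cv Pv zv dv H1; have := dist_step cu Pu zu du H2.
by rewrite (enormB (z (u i)) (z (v i))) ler_norml; lra.
Qed.

End Distance.

(** * Logarithmic Gronwall estimate off a null set *)

Section Gronwall.
Set Implicit Arguments. Unset Strict Implicit.
Context {R : realType}.
Notation mu := (@lebesgue_measure R).
Implicit Types (f G K : R -> R) (a b t : R) (N : set R).

Lemma ln_sub_le (x y : R) : 0 < x -> 0 < y -> ln x - ln y <= (x - y) / y.
Proof.
move=> x0 y0; have yn0 : y != 0 by rewrite gt_eqF.
rewrite -ln_div ?posrE// -[x in ln (x / y)](subrK y) mulrDl divff// addrC.
apply: le_ln1Dx; rewrite mulrBl divff//.
by have := divr_gt0 x0 y0; lra.
Qed.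

Lemma ac_lipschitz f g (c a b : R) : 0 < c -> ac g a b ->
  (forall x y, `|f x - f y| <= c * `|g x - g y|) -> ac f a b.
Proof.
move=> c0 acg fg e e0; have [|d d0 dP] := acg (e / c); first exact: divr_gt0.
exists d => // S L H Ld.
suff [S' H' SS'] : exists2 S', fam setT g a b S' L & S <= c * S'.
  by apply: le_trans SS' _; rewrite mulrC -ler_pdivlMr//; exact: dP H' Ld.
elim: H {Ld} => {b S L acg dP} [t at_|t S L u v w H [S' H' SS'] tu uv vw uvT].
  by exists 0; [exact: fam_nil|rewrite mulr0].
exists (S' + `|g v - g u|); first exact: (fam_cons H' tu uv vw uvT).
by rewrite mulrDr lerD.
Qed.

(** On values at least [e] the logarithm is Lipschitz with constant [1 / e]. *)
Lemma ac_ln G (e a b : R) : 0 < e -> (forall t, 0 <= G t) -> ac G a b ->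
  ac (fun t => ln (G t + e)) a b.
Proof.
move=> e0 G0 acG; apply: (@ac_lipschitz _ G e^-1 _ _ _ acG); first by rewrite invr_gt0.
have H x y : ln (G x + e) - ln (G y + e) <= e^-1 * `|G x - G y|.
  have xe : 0 < G x + e by have := G0 x; lra.
  have ye : 0 < G y + e by have := G0 y; lra.
  apply: le_trans (ln_sub_le xe ye) _; rewrite (_ : _ - _ = G x - G y); last lra.
  rewrite mulrC; apply: (@le_trans _ _ ((G y + e)^-1 * `|G x - G y|)).
    by rewrite ler_wpM2l ?invr_ge0 ?(ltW ye)// ler_norm.
  by rewrite ler_wpM2r// lef_pV2 ?posrE//; have := G0 y; lra.
move=> x y; rewrite ler_norml; have := H x y; have := H y x.
by rewrite (distrC (G y)); lra.
Qed.

(** The completed measure is the restriction of an outer measure, for which open sets approximate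
    from outside. *)
Lemma leb_negligible_open N (d : R) : leb.-negligible N -> 0 < d ->
  exists U : set R, [/\ open U, N `<=` U & (mu U < d%:E)%E].
Proof.
move=> [A [mA A0 NA]] d0; have d20 : 0 < d / 2 by lra.
have [U [oU AU]] := @outer_measure_open_le _ A _ d20.
have -> : ((wlength idfun)^*%mu A = 0)%E by exact: A0.
rewrite add0e => Ud; exists U; split => //; first exact: subset_trans AU.
by apply: le_lt_trans Ud _; rewrite lte_fin; lra.
Qed.

Lemma lebesgue_leb_negligible N : mu.-negligible N -> leb.-negligible N.
Proof.
move=> [A [mA A0 NA]]; exists A; split => //.
exact: sub_caratheodory.
Qed.

(* Comparison of [ln (G + e)] with [2 K], for every [e > 0]. *)
Lemma ae_gronwall G K a b N : a <= b -> continuous G -> ac G a b ->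
  (forall t, 0 <= G t) -> G a = 0 -> {homo K : x y / x <= y} ->
  leb.-negligible N ->
  (forall t, a < t <= b -> ~ N t -> G t = 0 \/ exists k l : R,
    [/\ 0 <= k, l <= 2 * k * G t,
      exists2 d, 0 < d & forall s, t - d < s < t -> k * (t - s) <= K t - K s &
      forall c, 0 < c -> exists2 d, 0 < d &
        forall s, t - d < s < t -> G t - G s <= (l + c) * (t - s)]) ->
  G b = 0.
Proof.
move=> ab cG acG G0 Ga Knd N0 step.
(* [B] bounds the growth of [2 K t + t + W t], whose terms pay for the rate, the error and the
   exceptional set. *)
pose B := 2 * (K b - K a) + 1 + (b - a).
suff H e : 0 < e -> G b <= e * expR B.
  apply/eqP; rewrite eq_le G0 andbT; apply/ler_addgt0Pr => e e0; rewrite add0r.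
  have := H (e / expR B); rewrite divfK ?gt_eqF ?expR_gt0//; apply.
  by rewrite divr_gt0// expR_gt0.
move=> e0; pose f t := ln (G t + e).
have Ge t : 0 < G t + e by have := G0 t; lra.
have acf : ac f a b by exact: ac_ln.
have cf : continuous f.
  move=> t; apply: (@continuous_comp _ _ _ (fun t => G t + e) (@ln R)).
    by apply: cvgD; [exact: cG|exact: cvg_cst].
  exact: continuous_ln.
have [d d0 dP] := ac_small_variation acf ltr01.
have [U [oU NU Ud]] := leb_negligible_open N0 d0.
have [W [W1 W2 W3]] := dP U oU Ud.
pose V t := 2 * K t + t + W t.
have Vnd : {in `[a, b] &, {homo V : x y / x <= y}}.
  move=> x y xI yI xy; rewrite /V.
  by have := W1 x y xI yI xy; have := Knd x y xy; lra.
have : f b - f a <= V b - V a.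
  apply: creep_left => // t /andP[at_ tb].
  have WI s : a <= s <= t -> W s <= W t by move=> sI; apply: W1; rewrite ?in_itv/=; lra.
  have KI s : s <= t -> K s <= K t by exact: Knd.
  have [Ut|nUt] := pselect (U t).
    have := oU; rewrite openE => /(_ t Ut)[r /= r0 rU].
    pose s := Num.max a (t - r / 2).
    have st : s < t by rewrite gt_max; lra.
    have as_ : a <= s by rewrite le_max lexx.
    have sr : t - r / 2 <= s by rewrite le_max lexx orbT.
    exists s; first by rewrite as_.
    have := W3 s t ltac:(lra) tb.
    have /[swap]/[apply] : `]s, t[ `<=` U.
      by move=> x /=; rewrite in_itv/= => xI; apply: rU; rewrite /ball/= ltr_norml; lra.
    by rewrite ler_norml /V; have := KI s (ltW st); lra.
  have [|Gt0|[k [l [k0 lk [d1 d10 Kk] Gl]]]] := step t _ (contra_not (@NU t) nUt).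
  - by rewrite at_.
  (* At a zero of [G], jump back to [a], where [f] has the same value [ln e]. *)
  - exists a; first by rewrite lexx.
    have : f t <= f a by rewrite /f Gt0 Ga.
    have := WI a ltac:(lra); have := KI a (ltW at_); rewrite /V; lra.
  set x := G t + e.
  pose c := e / 2; have c0 : 0 < c by rewrite /c; lra.
  pose A := 2 * k * x + c.
  have x0 : 0 < x by exact: Ge.
  have A0 : 0 < A by rewrite /A ltr_wpDl// !mulr_ge0// ltW.
  have k20 : 0 < 2 * k + 1 by lra.
  have lA : l + c <= A.
    suff : 2 * k * G t <= 2 * k * x by rewrite /A; lra.
    by rewrite ler_wpM2l ?mulr_ge0// /x; lra.
  have [d2 d20 Gd] := Gl c c0.
  (* The last bound makes [(2 k + 1) A h <= c]. Then [y >= x - A h] and [x >= e = 2 c] give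
     [A <= (2 k + 1) y], which removes the denominator [y] of the logarithmic bound. *)
  pose h := Num.min (Num.min (d1 / 2) (d2 / 2)) (Num.min (t - a) (c / ((2 * k + 1) * A))).
  have h0 : 0 < h by rewrite !lt_min !divr_gt0 ?mulr_gt0//=; lra.
  have hd1 : h <= d1 / 2 by rewrite /h !ge_min lexx.
  have hd2 : h <= d2 / 2 by rewrite /h !ge_min lexx !orbT.
  have hta : h <= t - a by rewrite /h !ge_min lexx !orbT.
  have hc : (2 * k + 1) * A * h <= c.
    have : h <= c / ((2 * k + 1) * A) by rewrite /h !ge_min lexx !orbT.
    by rewrite ler_pdivlMr ?mulr_gt0// mulrC.
  exists (t - h); first by lra.
  have tsh : t - (t - h) = h by lra.
  have := Kk (t - h) ltac:(lra); have := Gd (t - h) ltac:(lra); rewrite !tsh.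
  set y := G (t - h) + e => Gth Kth.
  have y0 : 0 < y by exact: Ge.
  have xy : x - y <= A * h.
    have : (l + c) * h <= A * h by rewrite ler_wpM2r// ltW.
    by rewrite /x /y; lra.
  have : ln x - ln y <= (2 * k + 1) * h.
    apply: le_trans (ln_sub_le x0 y0) _; rewrite ler_pdivrMr//.
    apply: (le_trans xy).
    have : A <= (2 * k + 1) * y.
      have := ler_wpM2l (ltW k20) xy.
      have : x >= e by rewrite /x; have := G0 t; lra.
      rewrite /A /c in hc *; lra.
    by move=> /(ler_wpM2r (ltW h0)); rewrite mulrAC.
  have := WI (t - h) ltac:(lra); rewrite /V /f -/x -/y; lra.
have := W2 a; have := W2 b; rewrite !lexx ab => /(_ isT) ? /(_ isT) ?.
rewrite /V => fB.
have : f b <= ln e + B by rewrite /B; move: fB; rewrite {2}/f Ga add0r; lra.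
rewrite /f -[ln e + B]expRK ler_ln ?posrE ?expR_gt0// expRD lnK ?posrE//.
lra.
Qed.

End Gronwall.

(** * Invariance of [P] along solutions *)

Theorem theorem4p16 (R : realType) (n : nat) (T : R)
  (E : R -> 'rV[R]_n.+1 -> set 'rV[R]_n.+1)
  (P : R -> set 'rV[R]_n.+1) (C : set R) :
  (* (E1) *)
  (forall t z, 0 <= t <= T -> E t z !=set0 /\ closed (E t z) /\ cvx (E t z)) ->
  (* (E2) *)
  (forall t, 0 <= t <= T -> closed [set p | E t p.1 p.2]) ->
  (* (E3) *)
  (forall t, 0 <= t <= T -> sv_lsc (E t)) ->
  (* (E4) *)
  (forall z, sv_measurable T (fun t => E t z)) ->
  (* (ELC) *)
  (forall r : R, 0 < r -> exists k : R -> R,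
     (forall t, 0 <= t <= T -> 0 <= k t) /\
     leb.-integrable `[0, T] (EFin \o k) /\
     forall t x y, 0 <= t <= T -> cball r x -> cball r y ->
       E t x `<=` [set w | exists u, E t y u /\
                     exists c, cyl c /\ w = u + (k t * enorm (x - y)) *: c]) ->
  (* P : nonempty closed values, absolutely continuous *)
  (forall t, 0 <= t <= T -> P t !=set0 /\ closed (P t)) ->
  sv_abs_cont T P ->
  (* C of full measure in (0,T) *)
  C `<=` `]0, T[ -> leb.-negligible (`]0, T[ `\` C) ->
  (forall t z, C t -> P t z -> forall e, E t z e ->
     clconv (tcone (gph T P) (t, z)) (1, e)) ->
  forall t0 z0, 0 < t0 < T -> P t0 z0 ->
  forall z : R -> 'rV[R]_n.+1,
    abs_cont_on t0 T z ->
    {ae leb, forall t, t0 <= t <= T ->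
        derivable z t 1 /\ E t (z t) ('D_1 z t)} ->
    z t0 = z0 ->
    forall t, t0 <= t <= T -> P t (z t).
Proof.
move=> _ _ _ _ ELC Pcl acP CT Cnull tang t0 z0 t0I Pz0 z acz zE zt0.
have [M M0 zM] := dist_bounded (ltW (andP t0I).1) acP Pcl acz.
have t0T : t0 <= T by case/andP: t0I => _ /ltW.
pose g t := dist (z t) (P t).
have acg : ac g t0 T := dist_ac (ltW (andP t0I).1) acP Pcl acz zM.
have [acG cG] := ac_clamp t0T acg.
pose G := g \o clamp t0 T.
have Gg t : t0 <= t <= T -> G t = g t by move=> tI; rewrite /G/= clampE.
(* The ball of radius [M + M] holds both [z t] and its nearest point in [P t]. *)
have [k [k0 [ik kE]]] := ELC (M + M) ltac:(lra).
have [|K Knd Kk] := monotone_majorant _ k0 ik; first by lra.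
have Sub := ac_subdiff_ae cG acG.
set N3 := [set t | _] in Sub.
(* Bad times: outside [C], no derivative in [E], no subgradient, and [T] itself, past which [G] is
   constant and need not be the distance. *)
pose N := (`]0, T[ `\` C) `|` ((~` [set t | t0 <= t <= T ->
  derivable z t 1 /\ E t (z t) ('D_1 z t)]) `|` (N3 `|` [set T])).
have N0 : leb.-negligible N.
  apply: negligibleU => //; apply: negligibleU; first exact: zE.
  apply: negligibleU; apply: lebesgue_leb_negligible => //.
  by apply/negligibleP => //; exact: lebesgue_measure_set1.
have G0 t : 0 <= G t.
  have [P0 cP] := Pcl (clamp t0 T t) ltac:(have := clamp_in t t0T; lra).
  exact: dist_ge0.
move=> t1 t1I.
have [P0 cP] := Pcl t1 ltac:(lra).
have [y Py gy] := dist_attained (z t1) cP P0.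
suff : G t1 = 0.
  rewrite Gg// /g gy => /enorm_eq0/eqP; rewrite subr_eq0 => /eqP ->.
  exact: Py.
apply: (@ae_gronwall _ G K t0 t1 N) => //.
- by case/andP: t1I.
- by apply: ac_sub acG => //; case/andP: t1I.
- apply/eqP; rewrite eq_le G0 andbT Gg ?lexx// /g zt0.
  by apply: le_trans (dist_le z0 Pz0) _; rewrite subrr enorm0.
move=> {y Py gy P0 cP} t tI nN.
have tT : t < T.
  rewrite lt_neqAle; apply/andP; split; last by lra.
  by apply/eqP => tT; apply: nN; right; right; right.
have tI' : t0 <= t <= T by lra.
have t0T' : t0 < t < T by lra.
have tI0 : 0 <= t <= T by lra.
clear ELC Cnull zE acP acz acg cG Sub acG ik N0 Knd CT Pz0 zt0 t1I.
have Ct : C t.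
  apply: contrapT => nC; apply: nN; left; split => //.
  by rewrite /= in_itv/= tT andbT; case/andP: t0I t0T' => t00 _ /andP[/(lt_trans t00)].
have [dz Ez] : derivable z t 1 /\ E t (z t) ('D_1 z t).
  by apply: contrapT => nd; apply: nN; right; left => /(_ tI').
have [l Gl] : exists l, subdiff G t l.
  by apply: contrapT => nd; apply: nN; right; right; left; split.
have := G0 t; rewrite le_eqVlt => /predU1P[<-|Gt]; first by left.
right; exists (k t), l; split.
- exact: k0.
- have [P0 cP] := Pcl t tI0.
  have [y Py gy] := dist_attained (z t) cP P0.
  have [zt gt] := zM t tI'.
  have yM : cball (M + M) y.
    rewrite /cball/= -(subKr (z t) y) addrC (le_trans (enormD _ _))//.
    by rewrite enormN addrC lerD// -gy.
  have zc : cball (M + M) (z t) by rewrite /cball/=; lra.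
  (* The Lipschitz inclusion compares [z t] with its nearest point: [z'(t) = u + k(t) |z t - y| c],
     where [u] lies in [E t y] and the tangency hypothesis applies. *)
  have [u [Eu [c [cc wE]]]] := kE t (z t) y tI0 zc yM _ Ez.
  have GD : G t = enorm (z t - y) by rewrite Gg.
  have near_t : exists2 r, 0 < r & forall s, `|s - t| < r ->
      forall x, P s x -> G s <= enorm (z s - x).
    exists (Num.min (t - t0) (T - t)); first by rewrite lt_min; lra.
    move=> s; rewrite lt_min !ltr_norml => sI x Px.
    by rewrite Gg; [exact: dist_le|lra].
  have := tangent_halfspace (T := T) near_t Gl (derivable_expand dz) GD Gt.
  set q := z t - y => tcq.
  (* Collecting the terms in [p.1] exhibits the inequality as a half-space. *)
  have /clconv_halfspace H : tcone (gph T P) (t, y) `<=`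
      [set p | p.1 * (l * G t - dot q ('D_1 z t)) + dot q p.2 <= 0].
    by move=> p /tcq; rewrite dotBr dotZr /=; lra.
  have /= := H _ (tang t y Ct Py u Eu).
  rewrite [in X in X -> _]wE dotDr dotZr -/q -GD => H1.
  have kG : 0 <= k t * G t by apply: mulr_ge0; [exact: k0|exact: ltW].
  (* [|c| <= 2] turns [l G <= k G <q, c>] into [l G <= 2 k G^2], to be divided by [G > 0]. *)
  have qc : dot q c <= G t * 2.
    apply: le_trans (dot_le _ _) _; rewrite -GD.
    by apply: ler_wpM2l; [exact: ltW|exact: cyl_enorm].
  have H2 := ler_wpM2l kG qc.
  by rewrite -(ler_pM2r Gt); clear -H1 H2; lra.
- exact: Kk.
- move=> c c0; have [d d0 dP] := Gl c c0; exists d => // s sI.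
  clear -sI dP.
  (* A negative increment in the subgradient inequality bounds the growth of [G] from [s] up to
     [t]. *)
  have := dP (s - t); rewrite (addrC t) subrK ltr0_norm; last by lra.
  by move=> /(_ ltac:(lra)); lra.
Qed.
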